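(* Let $\Theta,\mathcal A,h,p,q$ satisfy the standing assumptions in the context, and suppose that $h(\boldsymbol\theta,\boldsymbol\alpha)$ is concave in $\boldsymbol\alpha$ for any given $\boldsymbol\theta$. Fix $\hat{\boldsymbol\alpha}\in\mathcal A$ and put $\lambda=\min\{L_{22},\frac{\epsilon}{2\sqrt2R}\}$, $h_\lambda(\boldsymbol\theta,\boldsymbol\alpha)=h(\boldsymbol\theta,\boldsymbol\alpha)-\frac\lambda2\|\boldsymbol\alpha-\hat{\boldsymbol\alpha}\|^2$. Then the Multi-step Accelerated Proximal Gradient Descent-Ascent algorithm (see context), applied to the regularized game $\min_{\boldsymbol\theta\in\Theta}\max_{\boldsymbol\alpha\in\mathcal A}h_\lambda(\boldsymbol\theta,\boldsymbol\alpha)-p(\boldsymbol\alpha)+q(\boldsymbol\theta)$ (i.e. with smooth part $\phi=h_\lambda$) with $\eta_1=\frac1{L_{22}+\lambda}$, $\eta_2=\big(L_{11}+\frac{L_{12}^2}{\lambda}\big)^{-1}$, $N=\sqrt{\frac{8(L_{22}+\lambda)}{\lambda}}-1$ and suitable $T=\mathcal O(\epsilon^{-3})$, $K=\mathcal O(\epsilon^{-1/2}\log(\epsilon^{-1}))$, requires $\mathcal O(\epsilon^{-3.5}\log(\epsilon^{-1}))$ gradient evaluations in order to find an $\epsilon$-first-order Nash equilibrium of the original game $\min_{\boldsymbol\theta\in\Theta}\max_{\boldsymbol\alpha\in\mathcal A}h(\boldsymbol\theta,\boldsymbol\alpha)-p(\boldsymbol\alpha)+q(\boldsymbol\theta)$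.
   Context: Norms are Euclidean. Standing assumptions: $\Theta\subseteq\mathbb R^{d_\theta}$ and $\mathcal A\subseteq\mathbb R^{d_\alpha}$ are convex and compact, and there are two separate balls of radius $R$ containing $\mathcal A$ and $\Theta$, respectively. $h(\boldsymbol\theta,\boldsymbol\alpha)$ is continuously differentiable in both arguments; $p$ and $q$ are convex and possibly non-differentiable, $p$ is $L_p$-Lipschitz continuous, $q$ is continuous. There are constants $L_{11},L_{22},L_{12}$ such that for all $\boldsymbol\theta,\boldsymbol\theta_1,\boldsymbol\theta_2\in\Theta$ and $\boldsymbol\alpha,\boldsymbol\alpha_1,\boldsymbol\alpha_2\in\mathcal A$: $\|\nabla_{\boldsymbol\theta}h(\boldsymbol\theta_1,\boldsymbol\alpha)-\nabla_{\boldsymbol\theta}h(\boldsymbol\theta_2,\boldsymbol\alpha)\|\le L_{11}\|\boldsymbol\theta_1-\boldsymbol\theta_2\|$, $\|\nabla_{\boldsymbol\alpha}h(\boldsymbol\theta,\boldsymbol\alpha_1)-\nabla_{\boldsymbol\alpha}h(\boldsymbol\theta,\boldsymbol\alpha_2)\|\le L_{22}\|\boldsymbol\alpha_1-\boldsymbol\alpha_2\|$, $\|\nabla_{\boldsymbol\alpha}h(\boldsymbol\theta_1,\boldsymbol\alpha)-\nabla_{\boldsymbol\alpha}h(\boldsymbol\theta_2,\boldsymbol\alpha)\|\le L_{12}\|\boldsymbol\theta_1-\boldsymbol\theta_2\|$, $\|\nabla_{\boldsymbol\theta}h(\boldsymbol\theta,\boldsymbol\alpha_1)-\nabla_{\boldsymbol\theta}h(\boldsymbol\theta,\boldsymbol\alpha_2)\|\le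 L_{12}\|\boldsymbol\alpha_1-\boldsymbol\alpha_2\|$. The $\mathcal O(\cdot)$ constants depend on the problem data but not on $\epsilon$. $\epsilon$-first-order Nash equilibrium of the original game: a point $(\bar{\boldsymbol\theta},\bar{\boldsymbol\alpha})$ with $\mathcal X(\bar{\boldsymbol\theta},\bar{\boldsymbol\alpha})\le\epsilon^2$ and $\mathcal Y(\bar{\boldsymbol\theta},\bar{\boldsymbol\alpha})\le\epsilon^2$, where $$\mathcal X(\bar{\boldsymbol\theta},\bar{\boldsymbol\alpha})=-2L_{11}\min_{\boldsymbol\theta\in\Theta}\Big[\langle\nabla_{\boldsymbol\theta}h(\bar{\boldsymbol\theta},\bar{\boldsymbol\alpha}),\boldsymbol\theta-\bar{\boldsymbol\theta}\rangle+q(\boldsymbol\theta)-q(\bar{\boldsymbol\theta})+\tfrac{L_{11}}2\|\boldsymbol\theta-\bar{\boldsymbol\theta}\|^2\Big],$$ $$\mathcal Y(\bar{\boldsymbol\theta},\bar{\boldsymbol\alpha})=2L_{22}\max_{\boldsymbol\alpha\in\mathcal A}\Big[\langle\nabla_{\boldsymbol\alpha}h(\bar{\boldsymbol\theta},\bar{\boldsymbol\alpha}),\boldsymbol\alpha-\bar{\boldsymbol\alpha}\rangle-p(\boldsymbol\alpha)+p(\bar{\boldsymbol\alpha})-\tfrac{L_{22}}2\|\boldsymbol\alpha-\bar{\boldsymbol\alpha}\|^2\Big].$$ The algorithm finds such a point in the sense that $(\boldsymbol\theta_t,\boldsymbol\alpha_{t+1})$ is one for some $t\in\{0,\dots,T-1\}$.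 Multi-step Accelerated Proximal Gradient Descent-Ascent algorithm for a game $\min_{\boldsymbol\theta\in\Theta}\max_{\boldsymbol\alpha\in\mathcal A}\phi(\boldsymbol\theta,\boldsymbol\alpha)-p(\boldsymbol\alpha)+q(\boldsymbol\theta)$ with smooth part $\phi$; inputs $K,T,N,\eta_1,\eta_2$, $\boldsymbol\alpha_0\in\mathcal A$, $\boldsymbol\theta_0\in\Theta$. Proximal operators with step size $\eta$: $$\rho_{\boldsymbol\alpha}(\tilde{\boldsymbol\theta},\tilde{\boldsymbol\alpha},\eta)=\arg\max_{\boldsymbol\alpha\in\mathcal A}\ \langle\nabla_{\boldsymbol\alpha}\phi(\tilde{\boldsymbol\theta},\tilde{\boldsymbol\alpha}),\boldsymbol\alpha-\tilde{\boldsymbol\alpha}\rangle-\tfrac1{2\eta}\|\boldsymbol\alpha-\tilde{\boldsymbol\alpha}\|^2-p(\boldsymbol\alpha),$$ $$\rho_{\boldsymbol\theta}(\tilde{\boldsymbol\theta},\tilde{\boldsymbol\alpha},\eta)=\arg\min_{\boldsymbol\theta\in\Theta}\ \langle\nabla_{\boldsymbol\theta}\phi(\tilde{\boldsymbol\theta},\tilde{\boldsymbol\alpha}),\boldsymbol\theta-\tilde{\boldsymbol\theta}\rangle+\tfrac1{2\eta}\|\boldsymbol\theta-\tilde{\boldsymbol\theta}\|^2+q(\boldsymbol\theta).$$ For $t=0,\dots,T-1$: (i) for $k=0,1,\dots,\lfloor K/N\rfloor$: set $\beta_1=1$, $\mathbf x_0=\boldsymbol\alpha_t$, and $\mathbf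 y_1=\mathbf x_0$ if $k=0$, while for $k\ge1$ set $\mathbf y_1$ equal to the $\mathbf x_N$ produced in round $k-1$; then for $j=1,\dots,N$ set $\mathbf x_j=\rho_{\boldsymbol\alpha}(\boldsymbol\theta_t,\mathbf y_j,\eta_1)$, $\beta_{j+1}=\frac{1+\sqrt{1+4\beta_j^2}}2$, $\mathbf y_{j+1}=\mathbf x_j+\frac{\beta_j-1}{\beta_{j+1}}(\mathbf x_j-\mathbf x_{j-1})$; (ii) set $\boldsymbol\alpha_{t+1}$ equal to the final $\mathbf x_N$; (iii) set $\boldsymbol\theta_{t+1}=\rho_{\boldsymbol\theta}(\boldsymbol\theta_t,\boldsymbol\alpha_{t+1},\eta_2)$.
   Formalization: The L22-Lipschitz bound on the α-gradient and concavity in α are assumed at all points 2x−x′ with x,x′ in A (where momentum can leave A), since with the bound only on A the claim fails; N is rounded up, and R>0, L22>0, L11+L12>0 are assumed so that the parameters are defined. *)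

(* Defs.v *)
From HB Require Import structures.
From mathcomp Require Export all_boot all_order all_algebra.
From mathcomp Require Export all_classical all_reals all_analysis.

Set Implicit Arguments.
Unset Strict Implicit.
Unset Printing Implicit Defensive.

Import Order.TTheory GRing.Theory Num.Theory.
Import numFieldNormedType.Exports.

Local Open Scope classical_set_scope.
Local Open Scope ring_scope.

Section Euclidean.
Context {R : realType} {n : nat}.
Implicit Types (x y : 'rV[R]_n) (f : 'rV[R]_n -> R) (S : set 'rV[R]_n).

Definition dot x y : R := \sum_i x ord0 i * y ord0 i.

(* The norm `|x| that the library puts on 'rV[R]_n is the sup norm; it is only
   used here through the topology it induces. *)
Definition enorm x : R := Num.sqrt (dot x x).

Definition gradient f x : 'rV[R]_n := \row_i 'D_(delta_mx ord0 i) f x.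

Definition is_minimizer S f x := S x /\ forall y, S y -> f x <= f y.
Definition is_maximizer S f x := S x /\ forall y, S y -> f y <= f x.

(* The default value 0 is only taken when there is no minimizer (maximizer). *)
Definition argmin S f : 'rV[R]_n := xget 0 [set x | is_minimizer S f x].
Definition argmax S f : 'rV[R]_n := xget 0 [set x | is_maximizer S f x].

Definition minval S f : R := f (argmin S f).
Definition maxval S f : R := f (argmax S f).

(* The points 2x - x' with x, x' in S.  For convex S this is the convex set of
   all x + c (x - x') with x, x' in S and 0 <= c <= 1, that is, of all points
   that a momentum step from two points of S can produce; it contains S. *)
Definition extrapolation S : set 'rV[R]_n :=
  [set z | exists x x', [/\ S x, S x' & z = x + (x - x')]].

End Euclidean.

Section Game.
Context {R : realType} {m n : nat}.
Implicit Types (h : 'rV[R]_m -> 'rV[R]_n -> R) (t : 'rV[R]_m) (a : 'rV[R]_n).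

Definition grad_theta h t a : 'rV[R]_m := gradient (fun t' => h t' a) t.
Definition grad_alpha h t a : 'rV[R]_n := gradient (fun a' => h t a') a.

Definition C1 h :=
  [/\ forall z : 'rV[R]_m * 'rV[R]_n, differentiable (fun w => h w.1 w.2) z,
      continuous (fun z : 'rV[R]_m * 'rV[R]_n => grad_theta h z.1 z.2) &
      continuous (fun z : 'rV[R]_m * 'rV[R]_n => grad_alpha h z.1 z.2)].

Definition statX (Theta : set 'rV[R]_m) h (q : 'rV[R]_m -> R) (L11 : R) t a
  : R :=
  - (2 * L11) * minval Theta (fun t' =>
      dot (grad_theta h t a) (t' - t) + q t' - q t
      + L11 / 2 * enorm (t' - t) ^+ 2).

Definition statY (A : set 'rV[R]_n) h (p : 'rV[R]_n -> R) (L22 : R) t a : R :=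
  2 * L22 * maxval A (fun a' =>
      dot (grad_alpha h t a) (a' - a) - p a' + p a
      - L22 / 2 * enorm (a' - a) ^+ 2).

Definition first_order_NE (Theta : set 'rV[R]_m) (A : set 'rV[R]_n) h
    (p : 'rV[R]_n -> R) (q : 'rV[R]_m -> R) (L11 L22 eps : R) t a :=
  [/\ Theta t, A a, statX Theta h q L11 t a <= eps ^+ 2
    & statY A h p L22 t a <= eps ^+ 2].

Definition regularized h (lambda : R) (ahat : 'rV[R]_n) t a : R :=
  h t a - lambda / 2 * enorm (a - ahat) ^+ 2.

End Game.

Section Algorithm.
Context {R : realType} {m n : nat}.
Context (Theta : set 'rV[R]_m) (A : set 'rV[R]_n).
Context (phi : 'rV[R]_m -> 'rV[R]_n -> R).
Context (p : 'rV[R]_n -> R) (q : 'rV[R]_m -> R).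

Definition prox_alpha (t : 'rV[R]_m) (a : 'rV[R]_n) (eta : R) : 'rV[R]_n :=
  argmax A (fun a' => dot (grad_alpha phi t a) (a' - a)
                      - 1 / (2 * eta) * enorm (a' - a) ^+ 2 - p a').

Definition prox_theta (t : 'rV[R]_m) (a : 'rV[R]_n) (eta : R) : 'rV[R]_m :=
  argmin Theta (fun t' => dot (grad_theta phi t a) (t' - t)
                          + 1 / (2 * eta) * enorm (t' - t) ^+ 2 + q t').

Context (K N : nat) (eta1 eta2 : R).

(* Inner state after j steps: x_j, y_{j+1}, beta_{j+1}, and the number of
   gradient evaluations made since the start of the algorithm; each application
   of a proximal operator evaluates exactly one gradient. *)
Record inner_state := Inner {
  in_x : 'rV[R]_n; in_y : 'rV[R]_n; in_beta : R; in_evals : nat }.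

Definition inner_step (t : 'rV[R]_m) (s : inner_state) : inner_state :=
  let x := prox_alpha t (in_y s) eta1 in
  let beta := (1 + Num.sqrt (1 + 4 * in_beta s ^+ 2)) / 2 in
  Inner x (x + ((in_beta s - 1) / beta) *: (x - in_x s)) beta (in_evals s).+1.

Definition inner_round (t : 'rV[R]_m) (x0 y1 : 'rV[R]_n) (evals : nat) :=
  iter N (inner_step t) (Inner x0 y1 1 evals).

(* The rounds k = 0, ..., K %/ N. *)
Definition inner_loop (t : 'rV[R]_m) (a : 'rV[R]_n) (evals : nat) :=
  iter (K %/ N) (fun s => inner_round t a (in_x s) (in_evals s))
       (inner_round t a a evals).

Record outer_state := Outer {
  out_theta : 'rV[R]_m; out_alpha : 'rV[R]_n; out_evals : nat }.

Definition outer_step (s : outer_state) : outer_state :=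
  let r := inner_loop (out_theta s) (out_alpha s) (out_evals s) in
  Outer (prox_theta (out_theta s) (in_x r) eta2) (in_x r) (in_evals r).+1.

(* The state (theta_t, alpha_t) after t outer iterations. *)
Definition MAPGDA (theta0 : 'rV[R]_m) (alpha0 : 'rV[R]_n) (t : nat)
  : outer_state :=
  iter t outer_step (Outer theta0 alpha0 0%N).

End Algorithm.

Section Tuning.
Context {R : realType}.

Definition reg_weight (L22 rad eps : R) : R :=
  Num.min L22 (eps / (2 * Num.sqrt 2 * rad)).

Definition step_alpha (L22 lambda : R) : R := 1 / (L22 + lambda).

Definition step_theta (L11 L12 lambda : R) : R := (L11 + L12 ^+ 2 / lambda)^-1.

(* The number of inner steps is an integer: the real value is rounded up. *)
Definition inner_length (L22 lambda : R) : nat :=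
  `|Num.ceil (Num.sqrt (8 * (L22 + lambda) / lambda) - 1)|%N.

End Tuning.

(* Main.v *)
Require Import Defs.
From mathcomp Require Import ring lra.

(* On each round of N steps FISTA halves the gap of the lambda-strongly concave
   inner problem, so that K = O(N log (1 / eps)) makes both the gap and the
   distance of alpha_{t+1} to the inner maximizer polynomially small in eps.
   The inner maximum, as a function of theta, then satisfies a descent inequality
   with constant Lg = L11 + L12^2 / lambda = O(1 / eps) up to that small error, so
   the T = O(Lg / eps^2) proximal steps in theta, whose decreases telescope,
   include one whose decrease is at most of order eps^2 / Lg; there the theta
   criterion holds.  The alpha criterion holds at every t: the gap controls it for
   the regularized game, and passing to h costs (16 / 3) lambda^2 rad^2, which the
   choice of lambda makes at most (2 / 3) eps^2. *)

(** The momentum points of the inner loop may leave [A], yet the proximal step is analysed through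
    first-order models of the smooth part based at those points. This is why smoothness and
    concavity in the second variable are taken on [extrapolation A], and why the models are built on
    that convex set. Within a round the strong concavity is discarded: a round only yields the
    sublinear bound in terms of the distance from its starting point to the maximizer. Quadratic
    growth turns the previous gap into that distance, and this is what makes restarting linearly
    convergent. In the outer loop the quantity that telescopes is the exact inner maximum, which the
    algorithm never computes. The inexactness of alpha_{t+1} is therefore paid once, at the selected
    iteration, and is not summed over the T iterations. There it is multiplied by Lg, so the
    distance to the maximizer must be of order eps^3, which costs only a logarithmic number of
    rounds. *)

Set Implicit Arguments.
Unset Strict Implicit.
Unset Printing Implicit Defensive.

Import Order.TTheory GRing.Theory Num.Theory.
Import numFieldNormedType.Exports.

Local Open Scope classical_set_scope.
Local Open Scope ring_scope.

(** * Euclidean geometry and convexity *)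

Section EuclideanTheory.
Context {R : realType} {n : nat}.
Implicit Types (x y z g : 'rV[R]_n) (c s : R) (S : set 'rV[R]_n).

Lemma dotC x y : dot x y = dot y x.
Proof. by apply: eq_bigr => i _; rewrite mulrC. Qed.

Lemma dotDl x y z : dot (x + y) z = dot x z + dot y z.
Proof.
by rewrite /dot -big_split; apply: eq_bigr => i _; rewrite mxE mulrDl.
Qed.

Lemma dotZl c x y : dot (c *: x) y = c * dot x y.
Proof. by rewrite /dot mulr_sumr; apply: eq_bigr => i _; rewrite mxE mulrA. Qed.

Lemma dotNl x y : dot (- x) y = - dot x y.
Proof. by rewrite -scaleN1r dotZl mulN1r. Qed.

Lemma dotDr x y z : dot x (y + z) = dot x y + dot x z.
Proof. by rewrite dotC dotDl !(dotC _ x). Qed.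

Lemma dotZr c x y : dot x (c *: y) = c * dot x y.
Proof. by rewrite dotC dotZl dotC. Qed.

Lemma dotNr x y : dot x (- y) = - dot x y.
Proof. by rewrite dotC dotNl dotC. Qed.

Lemma dotr0 x : dot x 0 = 0.
Proof. by rewrite -(scale0r 0) dotZr mul0r. Qed.

Definition dotE := (dotDl, dotDr, dotZl, dotZr, dotNl, dotNr).

Lemma dot_ge0 x : 0 <= dot x x.
Proof. by apply: sumr_ge0 => i _; rewrite -expr2 sqr_ge0. Qed.

Lemma enorm_sqr x : enorm x ^+ 2 = dot x x.
Proof. by rewrite sqr_sqrtr ?dot_ge0. Qed.

Lemma enorm_ge0 x : 0 <= enorm x.
Proof. exact: sqrtr_ge0. Qed.

Lemma enormN x : enorm (- x) = enorm x.
Proof. by rewrite /enorm dotNl dotNr opprK. Qed.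

Lemma enormBC x y : enorm (x - y) = enorm (y - x).
Proof. by rewrite -enormN opprB. Qed.

Lemma enorm0 : enorm (0 : 'rV[R]_n) = 0.
Proof. by rewrite /enorm dotr0 sqrtr0. Qed.

Lemma enormZ c x : enorm (c *: x) = `|c| * enorm x.
Proof. by rewrite /enorm dotZl dotZr mulrA -expr2 sqrtrM ?sqr_ge0 // sqrtr_sqr. Qed.

Lemma enorm_sqrZ c x : enorm (c *: x) ^+ 2 = c ^+ 2 * enorm x ^+ 2.
Proof. by rewrite !enorm_sqr dotZl dotZr mulrA. Qed.

Lemma enorm_le x c : 0 <= c -> (enorm x <= c) = (enorm x ^+ 2 <= c ^+ 2).
Proof. by move=> c0; rewrite ler_sqr // nnegrE enorm_ge0. Qed.

Lemma dot_young c x y : 0 < c ->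
  dot x y <= c / 2 * enorm x ^+ 2 + enorm y ^+ 2 / (2 * c).
Proof.
move=> c0; rewrite !enorm_sqr; have := dot_ge0 (c *: x - y).
rewrite !dotE (dotC y x) => sq_ge0.
rewrite -subr_ge0; suff -> : c / 2 * dot x x + dot y y / (2 * c) - dot x y
  = (c * (c * dot x x) + - (c * dot x y) + (c * - dot x y + - - dot y y)) / (2 * c).
  by apply: divr_ge0; [lra|rewrite mulr_ge0 // ltW].
by field; rewrite gt_eqF.
Qed.

Lemma enorm_eq0 x : enorm x = 0 -> x = 0.
Proof.
move=> x0; have /psumr_eq0P : \sum_i x ord0 i * x ord0 i = 0.
  by rewrite -[LHS]/(dot x x) -enorm_sqr x0 expr0n.
move=> xi; apply/rowP => i; rewrite mxE; apply/eqP.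
by rewrite -[_ == 0]orbb -mulf_eq0 xi // => k _; rewrite -expr2 sqr_ge0.
Qed.

Lemma cauchy_schwarz x y : dot x y <= enorm x * enorm y.
Proof.
have [->|x0] := eqVneq x 0; first by rewrite dotC dotr0 enorm0 mul0r.
have [->|y0] := eqVneq y 0; first by rewrite dotr0 enorm0 mulr0.
have xp : 0 < enorm x.
  by rewrite lt_def enorm_ge0 andbT; apply: contra_neq x0; exact: enorm_eq0.
have yp : 0 < enorm y.
  by rewrite lt_def enorm_ge0 andbT; apply: contra_neq y0; exact: enorm_eq0.
apply: le_trans (dot_young x y (divr_gt0 yp xp)) _.
by rewrite le_eqVlt; apply/orP; left; apply/eqP; field; rewrite !gt_eqF.
Qed.

Lemma enormD x y : enorm (x + y) <= enorm x + enorm y.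
Proof.
rewrite enorm_le ?addr_ge0 ?enorm_ge0 // enorm_sqr !dotE (dotC y x).
rewrite sqrrD !enorm_sqr; have := cauchy_schwarz x y; lra.
Qed.

Lemma enorm_ball a x y r : enorm (x - a) <= r -> enorm (y - a) <= r ->
  enorm (x - y) <= 2 * r.
Proof.
move=> xa ya; rewrite (_ : x - y = (x - a) + (a - y)); last first.
  by rewrite addrA subrK.
by apply: le_trans (enormD _ _) _; rewrite (enormBC a); lra.
Qed.

Lemma continuous_coordr i : continuous (fun x : 'rV[R]_n => x ord0 i).
Proof. exact: coord_continuous. Qed.

Lemma continuous_subr y : continuous (fun x => x - y).
Proof.
by move=> x; apply: continuousB; [exact: (fun _ _ => id)|exact: cst_continuous].
Qed.

Lemma continuous_dot (T : topologicalType) (f g : T -> 'rV[R]_n) :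
  continuous f -> continuous g -> continuous (fun u => dot (f u) (g u)).
Proof.
move=> cf cg u; rewrite /dot.
apply: cvg_big => [|i _]; first exact: add_continuous.
by apply: cvgM; apply: (continuous_comp _ (@continuous_coordr i _));
  [exact: cf|exact: cg].
Qed.

Lemma enorm_continuous : continuous (@enorm R n).
Proof.
move=> x; apply: continuous_comp; last exact: sqrt_continuous.
by apply: continuous_dot => y; exact: cvg_id.
Qed.

Lemma argminP S (f : 'rV[R]_n -> R) : S !=set0 -> compact S ->
  {within S, continuous f} -> is_minimizer S f (argmin S f).
Proof.
move=> S0 cS cf; apply: (@xgetPex _ 0 [set x | is_minimizer S f x]).
have [c cS' cmin] := compact_EVT_min S0 cS cf.
by exists c; split=> [|y Sy]; [exact: set_mem|apply/cmin/mem_set].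
Qed.

Lemma argmaxP S (f : 'rV[R]_n -> R) : S !=set0 -> compact S ->
  {within S, continuous f} -> is_maximizer S f (argmax S f).
Proof.
move=> S0 cS cf; apply: (@xgetPex _ 0 [set x | is_maximizer S f x]).
have [c cS' cmax] := compact_EVT_max S0 cS cf.
by exists c; split=> [|y Sy]; [exact: set_mem|apply/cmax/mem_set].
Qed.

Lemma lipschitz_within_continuous S (f : 'rV[R]_n -> R) c :
  (forall x y, S x -> S y -> `|f x - f y| <= c * enorm (x - y)) ->
  {within S, continuous f}.
Proof.
move=> fc; apply/subspace_continuousP => x Sx; apply/cvgrPdist_lt => e e0.
(* The sign of [c] is unknown; [|c| + 1] is a positive Lipschitz constant in every case. *)
have c1 : 0 < `|c| + 1 by rewrite ltr_wpDl.
have : (fun y => enorm (y - x)) y @[y --> x] --> enorm (x - x).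
  apply: (@continuous_comp _ _ _ (fun y => y - x) (@enorm R n)).
    exact: continuous_subr.
  exact: enorm_continuous.
move/cvgrPdist_lt => /(_ (e / (`|c| + 1))); rewrite divr_gt0 // => /(_ isT).
rewrite subrr enorm0; apply: filterS => y + Sy.
rewrite sub0r normrN enormBC ger0_norm ?enorm_ge0 // ltr_pdivlMr // => xye.
apply: le_lt_trans (fc _ _ Sx Sy) _.
apply: le_lt_trans xye; rewrite mulrC ler_wpM2l ?enorm_ge0 //.
by apply: le_trans (ler_norm c) _; rewrite lerDl.
Qed.

Lemma model_continuous S (f : 'rV[R]_n -> R) g y c :
  {within S, continuous f} ->
  {within S, continuous (fun x => dot g (x - y) + c * enorm (x - y) ^+ 2 + f x)}.
Proof.
move=> cf; have cB := @continuous_subr y.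
pose f1 x : R := dot g (x - y); pose f2 x : R := dot (x - y) (x - y).
have c1 : continuous f1 by apply: continuous_dot => //; exact: cst_continuous.
have c2 : continuous f2 by exact: continuous_dot.
have cg : continuous (f1 + cst c * f2 : _ -> R).
  move=> x; apply: continuousD; first exact: c1.
  by apply: continuousM; [exact: cst_continuous|exact: c2].
under eq_fun do rewrite enorm_sqr.
by move=> x; apply: cvgD; [exact: (continuous_subspaceT cg)|exact: cf].
Qed.

(** The segment form involves no gradient, so it applies to sums with the nonsmooth [p] and [q];
    [mu = 0] is plain convexity. *)
Definition strongly_convex S (mu : R) (f : 'rV[R]_n -> R) :=
  forall x y s, S x -> S y -> 0 <= s -> s <= 1 ->
    f (s *: x + (1 - s) *: y) <=
      s * f x + (1 - s) * f y - mu / 2 * (s * (1 - s)) * enorm (x - y) ^+ 2.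

Lemma convex_setE S x y s : convex_set S -> S x -> S y -> 0 <= s -> s <= 1 ->
  S (s *: x + (1 - s) *: y).
Proof.
move=> cS Sx Sy s0 s1; apply: set_mem.
exact: (cS x y (@Itv01 _ s s0 s1) (mem_set Sx) (mem_set Sy)).
Qed.

Lemma convex_function_strongly_convex S f :
  convex_function S f -> strongly_convex S 0 f.
Proof.
move=> cf x y s Sx Sy s0 s1; rewrite mul0r !mul0r subr0.
exact: (cf (@Itv01 _ s s0 s1) x y (mem_set Sx) (mem_set Sy)).
Qed.

Lemma strongly_convexD S mu1 mu2 f1 f2 :
  strongly_convex S mu1 f1 -> strongly_convex S mu2 f2 ->
  strongly_convex S (mu1 + mu2) (fun x => f1 x + f2 x).
Proof.
move=> cf1 cf2 x y s Sx Sy s0 s1.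
by have := cf1 x y s Sx Sy s0 s1; have := cf2 x y s Sx Sy s0 s1; lra.
Qed.

Lemma strongly_convex_model S c g y : strongly_convex S c
  (fun x => dot g (x - y) + c / 2 * enorm (x - y) ^+ 2).
Proof.
move=> u v s _ _ _ _; rewrite !enorm_sqr !dotE (dotC v u) !(dotC y).
by rewrite le_eqVlt; apply/orP; left; apply/eqP; field.
Qed.

Lemma strongly_convexS S S' mu f : S' `<=` S ->
  strongly_convex S mu f -> strongly_convex S' mu f.
Proof. by move=> S'S cf x y s /S'S Sx /S'S Sy; exact: cf. Qed.

(** Minimality is tested at the points [s *: u + (1 - s) *: x]; dividing by [s] and letting [s] tend
    to 0 leaves the full quadratic term, without any subgradient of [f]. *)
Lemma strongly_convex_growth S mu f x u :
  convex_set S -> strongly_convex S mu f -> is_minimizer S f x -> S u ->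
  f x + mu / 2 * enorm (u - x) ^+ 2 <= f u.
Proof.
move=> cS cf [Sx xmin] Su; set d := mu / 2 * _.
have key s : 0 < s -> s <= 1 -> (1 - s) * d <= f u - f x.
  move=> s0 s1; have := xmin _ (convex_setE cS Su Sx (ltW s0) s1).
  move=> /le_trans /(_ (cf _ _ _ Su Sx (ltW s0) s1)).
  have -> : mu / 2 * (s * (1 - s)) * enorm (u - x) ^+ 2 = s * ((1 - s) * d).
    by rewrite /d; field.
  move=> le; rewrite -(ler_pM2l s0); lra.
rewrite -lerBrDl; case: (lerP d 0) => d0.
  by apply: le_trans d0 _; have := key 1 ltr01 (lexx _); rewrite subrr mul0r.
apply/ler_addgt0Pl => e e0.
(* The limit is replaced by one explicit [s] for which [s * d] is at most the tolerance [e]. *)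
have s0 : 0 < Num.min 1 (e / d) by rewrite lt_min ltr01 divr_gt0.
have s1 : Num.min 1 (e / d) <= 1 by rewrite ge_min lexx.
have s2 : Num.min 1 (e / d) * d <= e.
  by rewrite -ler_pdivlMr // ge_min lexx orbT.
have := key _ s0 s1; lra.
Qed.

End EuclideanTheory.

(** * Gradients *)

Section Gradient.
Context {R : realType} {n : nat}.
Implicit Types (x y v : 'rV[R]_n) (f : 'rV[R]_n -> R) (S : set 'rV[R]_n).

Lemma derive_gradient f x v : differentiable f x -> 'D_v f x = dot (gradient f x) v.
Proof.
move=> df; rewrite deriveE // [in LHS](row_sum_delta v) linear_sum.
by apply: eq_bigr => i _; rewrite linearZ -deriveE // mxE mulrC.
Qed.

Lemma derive_line f x v s :
  'D_1 (fun u : R => f (x + u *: v)) s = 'D_v f (x + s *: v).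
Proof.
rewrite /derive; set g1 := fun h => _; set g2 := fun h => _.
suff -> : g1 = g2 by [].
by apply/funext => h; rewrite /g1 /g2 /= [_%:A]mulr1 scalerDl addrCA.
Qed.

Lemma derivable_line f x v s :
  derivable (fun u : R => f (x + u *: v)) s 1 = derivable f (x + s *: v) v.
Proof.
rewrite /derivable; set g1 := fun h => _; set g2 := fun h => _.
suff -> : g1 = g2 by [].
by apply/funext => h; rewrite /g1 /g2 /= [_%:A]mulr1 scalerDl addrCA.
Qed.

Lemma is_derive_line f x v s : differentiable f (x + s *: v) ->
  is_derive s 1 (fun u : R => f (x + u *: v)) (dot (gradient f (x + s *: v)) v).
Proof.
move=> df; split; first by rewrite derivable_line; exact: diff_derivable.
by rewrite derive_line derive_gradient.
Qed.

Lemma gradientN f x : differentiable f x ->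
  gradient (fun y => - f y) x = - gradient f x.
Proof.
move=> df; apply/rowP => i; rewrite !mxE -[fun y => - f y]/(- f) deriveN //.
exact: diff_derivable.
Qed.

Lemma differentiable_sqdist y x : differentiable (fun z => dot (z - y) (z - y)) x.
Proof.
have dc i : differentiable (fun z : 'rV[R]_n => (z - y) ord0 i) x.
  have -> : (fun z : 'rV[R]_n => (z - y) ord0 i) =
      (fun z : 'rV[R]_n => z ord0 i : R) - cst (y ord0 i).
    by apply/funext => z; rewrite !mxE.
  by apply: differentiableB; [exact: differentiable_coord|exact: differentiable_cst].
rewrite /dot; have -> : (fun z => \sum_i (z - y) ord0 i * (z - y) ord0 i) =
    \sum_i ((fun z : 'rV[R]_n => (z - y) ord0 i) * (fun z => (z - y) ord0 i)).
  by apply/funext => z; rewrite fct_sumE.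
by apply: differentiable_sum => i; exact: differentiableM.
Qed.

Lemma derive_quadratic (a b c : R) :
  'D_1 (cst a + b *: id + c *: (id ^+ 2) : R -> R) (0 : R) = b.
Proof.
have d1 : is_derive (0 : R) 1 (b *: id : R -> R) (b *: 1) by exact: is_deriveZ.
have d2 : is_derive (0 : R) 1 (id ^+ 2 : R -> R) ((2%:R * 0 ^+ 1) *: 1).
  exact: is_deriveX.
have d3 : is_derive (0 : R) 1 (c *: (id ^+ 2) : R -> R)
  (c *: ((2%:R * 0 ^+ 1) *: 1)) by exact: is_deriveZ.
have d4 : is_derive (0 : R) 1 (cst a + b *: id : R -> R) (0 + b *: 1).
  exact: is_deriveD.
by have [_ ->] := is_deriveD d4 d3; rewrite /GRing.scale /=; ring.
Qed.

(** Along a coordinate direction the squared distance is a quadratic polynomial in the step, and its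
    linear coefficient is the partial derivative. *)
Lemma gradient_sqdist y x : gradient (fun z => dot (z - y) (z - y)) x = 2 *: (x - y).
Proof.
apply/rowP => i; rewrite !mxE.
set v := delta_mx _ _; rewrite -[x](addr0 x) -[X in x + X](scale0r v) -derive_line.
pose b := 2 * dot (x - y) v; pose c := dot v v.
have -> : (fun u : R => dot (x + u *: v - y) (x + u *: v - y)) =
    cst (dot (x - y) (x - y)) + b *: id + c *: (id ^+ 2).
  apply/funext => u; rewrite /b /c /cst !fctE /= /GRing.scale /= !dotE !(dotC y).
  by rewrite !(dotC v x) (dotC v y); ring.
have bE : b = 2 * (x ord0 i - y ord0 i).
  rewrite /b /dot (bigD1 i) //= big1 => [|j ji].
    by rewrite addr0 !mxE !eqxx mulr1.
  by rewrite [delta_mx _ _ _ _]mxE (negbTE ji) andbF mulr0.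
by rewrite derive_quadratic bE scale0r addr0.
Qed.

(** The mean value theorem takes the place of an integral: subtracting the linear and quadratic
    terms from [f] along the segment leaves a function [psi] whose derivative is nonpositive, by
    Cauchy-Schwarz and the Lipschitz bound. *)
Lemma descent_lemma S f L x y : convex_set S ->
  (forall z, S z -> differentiable f z) ->
  (forall z1 z2, S z1 -> S z2 ->
     enorm (gradient f z1 - gradient f z2) <= L * enorm (z1 - z2)) ->
  S x -> S y ->
  f y <= f x + dot (gradient f x) (y - x) + L / 2 * enorm (y - x) ^+ 2.
Proof.
move=> cS df fL Sx Sy; set d := y - x.
have Sl s : 0 <= s -> s <= 1 -> S (x + s *: d).
  move=> s0 s1; rewrite (_ : _ + _ = s *: y + (1 - s) *: x); first exact: convex_setE.
  by rewrite /d scalerBr scalerBl scale1r addrCA addrA.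
pose c1 := dot (gradient f x) d; pose c2 := L / 2 * enorm d ^+ 2.
pose psi : R -> R := (fun s => f (x + s *: d)) - c1 *: id - c2 *: (id ^+ 2).
pose dpsi (s : R) : R := dot (gradient f (x + s *: d)) d - c1 - c2 * (2 * s).
have psi_der (s : R) : 0 <= s -> s <= 1 -> is_derive s 1 psi (dpsi s).
  move=> s0 s1; have H := is_derive_line (df _ (Sl s s0 s1)).
  apply: is_derive_eq.
  by rewrite /dpsi /GRing.scale /=; ring.
have [||s /andP[s0 s1] psis] := @MVT R psi dpsi 0 1 ltr01.
- by move=> s /andP[/ltW s0 /ltW s1]; exact: psi_der.
- by apply: derivable_within_continuous => s /andP[s0 s1]; have [] := psi_der s s0 s1.
have s0' := ltW s0; have s1' := ltW s1.
have Ss := Sl s s0' s1'.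
have dps : dpsi s <= 0.
  have := cauchy_schwarz (gradient f (x + s *: d) - gradient f x) d.
  have := fL _ _ Ss Sx; rewrite (addrC x) addrK enormZ ger0_norm // => le1 le2.
  have := ler_wpM2r (enorm_ge0 d) le1.
  rewrite /dpsi /c1 /c2 (addrC x) !dotE in le2 *; lra.
have xd : x + d = y by rewrite addrC subrK.
have : psi 1 - psi 0 <= 0 by rewrite psis subr0 mulr1.
rewrite /psi !fctE !scale1r !scale0r addr0 xd /GRing.scale /= /c1 /c2; lra.
Qed.

(** Convexity bounds each right difference quotient along the segment by [f y - f x], and the bound
    passes to the limit. *)
Lemma convex_first_order S f x y : strongly_convex S 0 f ->
  differentiable f x -> S x -> S y ->
  f x + dot (gradient f x) (y - x) <= f y.
Proof.
move=> cf df Sx Sy; set d := y - x.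
have : is_derive (0 : R) 1 (fun u : R => f (x + u *: d))
    (dot (gradient f (x + 0 *: d)) d).
  by apply: is_derive_line; rewrite scale0r addr0.
rewrite scale0r addr0 => -[dl <-]; rewrite -lerBrDl.
apply: (cvgr_to_le (cvg_dnbhs_at_right dl)); near=> s.
have s0 : 0 < s by near: s; exact: nbhs_right_gt.
have s1 : s <= 1 by near: s; exact: nbhs_right_le.
rewrite /= scale0r !addr0 [s%:A]mulr1 [X in X <= _]mulrC ler_pdivrMr //.
have -> : x + s *: d = s *: y + (1 - s) *: x.
  by rewrite /d scalerBr scalerBl scale1r addrCA addrA.
by have := cf y x s Sy Sx (ltW s0) s1; rewrite !mul0r; lra.
Unshelve. all: by end_near. Qed.

End Gradient.

(** * The accelerated inner loop *)

Section Extrapolation.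
Context {R : realType} {n : nat}.
Implicit Types (x y : 'rV[R]_n) (c : R) (S : set 'rV[R]_n).

Lemma sub_extrapolation S : S `<=` extrapolation S.
Proof. by move=> x Sx; exists x, x; split=> //; rewrite subrr addr0. Qed.

Lemma extrapolation_convex S : convex_set S -> convex_set (extrapolation S).
Proof.
move=> cS x y l /set_mem[x1 [x2 [Sx1 Sx2 ->]]] /set_mem[y1 [y2 [Sy1 Sy2 ->]]].
apply: mem_set.
exists (l%:num *: x1 + (1 - l%:num) *: y1), (l%:num *: x2 + (1 - l%:num) *: y2).
split; [exact: convex_setE|exact: convex_setE|].
rewrite -[LHS]/(l%:num *: (x1 + (x1 - x2)) + (1 - l%:num) *: (y1 + (y1 - y2))).
by apply/rowP => i; rewrite !mxE; ring.
Qed.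

Lemma extrapolation_momentum S x y c : convex_set S -> S x -> S y ->
  0 <= c -> c <= 1 -> extrapolation S (x + c *: (x - y)).
Proof.
(* Moving the second point towards [x] by the factor [c] turns the momentum step into a full
   reflection. *)
move=> cS Sx Sy c0 c1; exists x, (c *: y + (1 - c) *: x).
split=> //; first exact: convex_setE.
by apply/rowP => i; rewrite !mxE; ring.
Qed.

End Extrapolation.

Section Inner.
Context {R : realType} {m n : nat}.
Context (A : set 'rV[R]_n) (phi : 'rV[R]_m -> 'rV[R]_n -> R) (p : 'rV[R]_n -> R).
Context (L mu : R) (t : 'rV[R]_m).
Hypotheses (A_convex : convex_set A) (A_compact : compact A).
Hypotheses (L_gt0 : 0 < L) (mu_gt0 : 0 < mu).
Hypothesis p_convex : convex_function A p.
Hypothesis p_continuous : {within A, continuous p}.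
Hypothesis phi_diff : forall a, differentiable (phi t) a.
Hypothesis phi_lip : forall a1 a2, extrapolation A a1 -> extrapolation A a2 ->
  enorm (grad_alpha phi t a1 - grad_alpha phi t a2) <= L * enorm (a1 - a2).
Hypothesis phi_concave :
  strongly_convex (extrapolation A) mu (fun a => - phi t a).

Implicit Types (a x y u : 'rV[R]_n).

Definition loss a := p a - phi t a.

Let prox y := prox_alpha A phi p t y (1 / L).

Lemma loss_strongly_convex : strongly_convex A mu loss.
Proof.
rewrite -[mu]add0r; apply: strongly_convexD.
  exact: convex_function_strongly_convex.
exact: strongly_convexS (@sub_extrapolation _ _ _) phi_concave.
Qed.

Lemma prox_alpha_minimizer y : A !=set0 ->
  is_minimizer A (fun a => dot (- grad_alpha phi t y) (a - y)
                           + L / 2 * enorm (a - y) ^+ 2 + p a) (prox y).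
Proof.
move=> A0; have pE a : dot (grad_alpha phi t y) (a - y)
    - 1 / (2 * (1 / L)) * enorm (a - y) ^+ 2 - p a
  = - (dot (- grad_alpha phi t y) (a - y) + L / 2 * enorm (a - y) ^+ 2 + p a).
  by rewrite dotNl; field; rewrite gt_eqF.
have -> : prox y = argmax A (fun a => - (dot (- grad_alpha phi t y) (a - y)
    + L / 2 * enorm (a - y) ^+ 2 + p a)).
  by congr (argmax A _); apply/funext => a; rewrite pE.
have [|Aprox pmax] := argmaxP (f := fun a => - (dot (- grad_alpha phi t y) (a - y)
   + L / 2 * enorm (a - y) ^+ 2 + p a)) A0 A_compact.
  by move=> x; apply: cvgN; exact: model_continuous.
by split=> // a Aa; rewrite -lerN2; exact: pmax.
Qed.

Lemma prox_alpha_in y : A !=set0 -> A (prox y).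
Proof. by move/(prox_alpha_minimizer y) => []. Qed.

(** This is the descent lemma for [- phi t], applied on [extrapolation A] because [y] will be a
    momentum point. *)
Lemma phi_lower_model y u : extrapolation A y -> extrapolation A u ->
  phi t y + dot (grad_alpha phi t y) (u - y) - L / 2 * enorm (u - y) ^+ 2
  <= phi t u.
Proof.
move=> Ey Eu.
have gN a : gradient (fun b => - phi t b) a = - grad_alpha phi t a.
  exact: gradientN.
have dN a : differentiable (fun b => - phi t b) a by exact: differentiableN.
have dL : forall z1 z2, extrapolation A z1 -> extrapolation A z2 ->
    enorm (gradient (fun b => - phi t b) z1 - gradient (fun b => - phi t b) z2)
    <= L * enorm (z1 - z2).
  by move=> z1 z2 E1 E2; rewrite !gN -opprD enormN; exact: phi_lip.
have := descent_lemma (extrapolation_convex A_convex) (fun z _ => dN z) dL Ey Eu.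
by rewrite gN dotNl; lra.
Qed.

Lemma phi_upper_model y u : extrapolation A y -> extrapolation A u ->
  phi t u <= phi t y + dot (grad_alpha phi t y) (u - y).
Proof.
move=> Ey Eu.
have gN : gradient (fun b => - phi t b) y = - grad_alpha phi t y.
  exact: gradientN.
have dN : differentiable (fun b => - phi t b) y by exact: differentiableN.
have sc0 : strongly_convex (extrapolation A) 0 (fun a => - phi t a).
  move=> a b s Ea Eb s0 s1; apply: le_trans (phi_concave Ea Eb s0 s1) _.
  rewrite !mul0r subr0 gerBl.
  apply: mulr_ge0; last exact: sqr_ge0.
  by apply: mulr_ge0; [exact/divr_ge0/ler0n/ltW|rewrite mulr_ge0 ?subr_ge0].
by have := convex_first_order sc0 dN Ey Eu; rewrite gN dotNl; lra.
Qed.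

(** The three-point inequality of proximal gradient methods: growth of the L-strongly convex model
    at its minimizer [prox y], the lower model of [phi] at [prox y] and the upper model at [u]. *)
Lemma prox_alpha_step y u : extrapolation A y -> A u ->
  loss (prox y) <= loss u + L / 2 * enorm (u - y) ^+ 2
                   - L / 2 * enorm (u - prox y) ^+ 2.
Proof.
move=> Ey Au; have A0 : A !=set0 by exists u.
have Apy := prox_alpha_in y A0.
have extA := @sub_extrapolation _ _ A.
have sc := strongly_convexD (@strongly_convex_model _ _ A L (- grad_alpha phi t y) y)
  (convex_function_strongly_convex p_convex).
have := strongly_convex_growth A_convex sc (prox_alpha_minimizer y A0) Au.
have := phi_lower_model Ey (extA _ Apy).
have := phi_upper_model Ey (extA _ Au).
by rewrite /loss addr0 !dotNl; lra.
Qed.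

Let step := inner_step A phi p (1 / L) t.

(* The state s after j steps holds x_j, y_{j+1} and b = beta_{j+1}, and
   b (y - x) + x = beta_j x_j - (beta_j - 1) x_{j-1}; as b^2 - b = beta_j^2,
   this is the usual potential of FISTA, extended by beta_0 = 0. *)
Definition potential z (s : inner_state) : R :=
  (in_beta s ^+ 2 - in_beta s) * (loss (in_x s) - loss z)
  + L / 2 * enorm (in_beta s *: (in_y s - in_x s) + in_x s - z) ^+ 2.

Definition admissible (s : inner_state) :=
  [/\ A (in_x s), extrapolation A (in_y s) & 1 <= in_beta s].

Lemma next_beta (b : R) : 1 <= b ->
  let b' := (1 + Num.sqrt (1 + 4 * b ^+ 2)) / 2 in
  b' ^+ 2 - b' = b ^+ 2 /\ b + 1 / 2 <= b'.
Proof.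
move=> b1 /=; set r := Num.sqrt _.
have r2 : r ^+ 2 = 1 + 4 * b ^+ 2.
  by rewrite sqr_sqrtr // addr_ge0 // mulr_ge0 // sqr_ge0.
split.
  have -> : ((1 + r) / 2) ^+ 2 - (1 + r) / 2 = (r ^+ 2 - 1) / 4 by field.
  by rewrite r2; field.
suff : 2 * b <= r by lra.
rewrite -ler_sqr ?nnegrE ?sqrtr_ge0 ?r2 //; lra.
Qed.

(** The momentum coefficient [(b - 1) / b'] lies in [0, 1], so the next extrapolated point stays in
    [extrapolation A]. *)
Lemma inner_step_admissible s : admissible s -> admissible (step s).
Proof.
move=> [Ax Ey b1]; have Ap := prox_alpha_in (in_y s) (ex_intro _ _ Ax).
have [bE bb] := next_beta b1; set b' := (1 + _) / 2 in bE bb.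
split; [exact: Ap| |by rewrite /= -/b'; lra]; rewrite /=.
have b'0 : 0 < b' by lra.
apply: extrapolation_momentum => //; rewrite -/b'.
  by rewrite divr_ge0 //; lra.
by rewrite ler_pdivrMr // mul1r; lra.
Qed.

Lemma potential_step z s : A z -> admissible s ->
  potential z (step s) <= potential z s.
Proof.
move=> Az adm; have [Ax Ey b1] := adm.
have [bE bb] := next_beta b1; rewrite /potential /= -/(prox (in_y s)).
set b' := (1 + _) / 2 in bE bb *; rewrite bE.
move: (in_x s) (in_y s) (in_beta s) Ax Ey b1 bE bb => {adm} x y b Ax Ey b1 bE bb.
have b0 : 0 < b by lra.
have b'0 : 0 < b' by lra.
set x' := prox y.
(* This comparison point is chosen so that [u - y] and [u - x'] are [- b^-1] times the vectors [w]
   and [w'] of the old and new potentials; multiplying the three-point inequality by [b ^+ 2] then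
   gives the claim. *)
pose u := b^-1 *: z + (1 - b^-1) *: x.
have bi0 : 0 <= b^-1 by rewrite invr_ge0 ltW.
have bi1 : b^-1 <= 1 by rewrite invf_le1.
have Au : A u by exact: convex_setE.
have Fu := loss_strongly_convex Az Ax bi0 bi1.
have q0 : 0 <= mu / 2 * (b^-1 * (1 - b^-1)) * enorm (z - x) ^+ 2.
  apply: mulr_ge0; last exact: sqr_ge0.
  by apply: mulr_ge0; [exact/divr_ge0/ler0n/ltW|rewrite mulr_ge0 ?subr_ge0].
have := prox_alpha_step Ey Au; rewrite -/x'.
set w := b *: (y - x) + x - z; set w' := b' *: _ + x' - z.
have -> : u - y = - b^-1 *: w.
  by apply/rowP => i; rewrite !mxE; field; rewrite gt_eqF.
have -> : u - x' = - b^-1 *: w'.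
  by apply/rowP => i; rewrite !mxE; field; rewrite !gt_eqF.
rewrite !enorm_sqrZ sqrrN => Fx'.
have b20 : 0 < b ^+ 2 by rewrite exprn_gt0.
have : b ^+ 2 * loss x' <= b ^+ 2 * (b^-1 * loss z + (1 - b^-1) * loss x
    + L / 2 * (b^-1 ^+ 2 * enorm w ^+ 2) - L / 2 * (b^-1 ^+ 2 * enorm w' ^+ 2)).
  by rewrite ler_pM2l //; lra.
have -> : b ^+ 2 * (b^-1 * loss z + (1 - b^-1) * loss x
    + L / 2 * (b^-1 ^+ 2 * enorm w ^+ 2) - L / 2 * (b^-1 ^+ 2 * enorm w' ^+ 2))
  = b * loss z + (b ^+ 2 - b) * loss x + L / 2 * enorm w ^+ 2
    - L / 2 * enorm w' ^+ 2.
  by field; rewrite gt_eqF.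
lra.
Qed.

(** At [b = 1] the potential equals [L / 2 * enorm (y1 - z) ^+ 2], so a round is measured from its
    restart point [y1] although [x0] remains alpha_t. After the last step the gap carries the
    coefficient beta_N^2, where beta_N is at least (N + 1) / 2. *)
Lemma inner_round_bound N x0 y1 e z : (0 < N)%N -> A x0 -> A y1 ->
  is_minimizer A loss z ->
  let x := in_x (inner_round A phi p N (1 / L) t x0 y1 e) in
  A x /\ (N.+1%:R / 2) ^+ 2 * (loss x - loss z) <= L / 2 * enorm (y1 - z) ^+ 2.
Proof.
move=> N0 Ax0 Ay1 [Az zmin]; rewrite /inner_round -/step.
set s0 := Inner _ _ _ _.
have adm0 : admissible s0 by split=> //; exact: sub_extrapolation.
have pot0 : potential z s0 = L / 2 * enorm (y1 - z) ^+ 2.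
  by rewrite /potential /= expr1n subrr mul0r add0r scale1r subrK.
have inv k : [/\ admissible (iter k step s0),
    potential z (iter k step s0) <= potential z s0 &
    1 + k%:R / 2 <= in_beta (iter k step s0)].
  elim: k => [|k [adm pot bk]] /=; first by split=> //=; lra.
  split; first exact: inner_step_admissible.
    exact: le_trans (potential_step Az adm) pot.
  have [_ _ /next_beta[_ bb]] := adm; rewrite /= -addn1 natrD; lra.
case: N N0 => // N _; have [[Ax _ _] pot _] := inv N.+1.
split=> //; rewrite -pot0; apply: le_trans pot.
have [[_ _ b1] _ bN] := inv N.
have [bE _] := next_beta b1.
rewrite /potential [in_beta (iter N.+1 _ _)]/= bE -[leLHS]addr0; apply: lerD.
  rewrite ler_wpM2r ?subr_ge0 ?zmin // ler_sqr ?nnegrE ?divr_ge0 //; last lra.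
  by rewrite -addn2 natrD; lra.
by rewrite mulr_ge0 ?sqr_ge0 // divr_ge0 // ltW.
Qed.

Lemma loss_growth z x : is_minimizer A loss z -> A x ->
  mu / 2 * enorm (x - z) ^+ 2 <= loss x - loss z.
Proof.
move=> zmin Ax.
by have := strongly_convex_growth A_convex loss_strongly_convex zmin Ax; lra.
Qed.

(** The length condition is tuned so that the constant [mu / 4] is half of the [mu / 2] in
    [loss_growth]; together they halve the gap from one round to the next. *)
Lemma inner_round_contraction N x0 y1 e z : (0 < N)%N ->
  8 * L <= mu * N.+1%:R ^+ 2 -> A x0 -> A y1 -> is_minimizer A loss z ->
  let x := in_x (inner_round A phi p N (1 / L) t x0 y1 e) in
  A x /\ loss x - loss z <= mu / 4 * enorm (y1 - z) ^+ 2.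
Proof.
move=> N0 NL Ax0 Ay1 zmin x.
have [Ax xb] := inner_round_bound e N0 Ax0 Ay1 zmin; split=> //.
rewrite -/x in Ax xb *; have gap0 : 0 <= loss x - loss z.
  by rewrite subr_ge0; case: zmin => _; apply.
rewrite -(ler_pM2l (_ : 0 < 2 * L)) ?mulr_gt0 //.
have := ler_wpM2r gap0 NL.
have := ler_wpM2l (ltW mu_gt0) xb; lra.
Qed.

(** Round 0 turns the distance bound [D] into a gap bound, and each of the [K %/ N] later rounds
    halves it. *)
Lemma inner_loop_bound K N a e z D : (0 < N)%N ->
  8 * L <= mu * N.+1%:R ^+ 2 -> A a -> is_minimizer A loss z ->
  enorm (a - z) <= D ->
  let x := in_x (inner_loop A phi p K N (1 / L) t a e) in
  A x /\ loss x - loss z <= mu / 4 * D ^+ 2 * (1 / 2) ^+ (K %/ N)%N.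
Proof.
move=> N0 NL Aa zmin aD; rewrite /inner_loop.
elim: (K %/ N)%N => [|k [Ax xb]] /=.
  have [Ax xb] := inner_round_contraction e N0 NL Aa Aa zmin; split=> //.
  apply: le_trans xb _; rewrite expr0 mulr1 ler_wpM2l ?divr_ge0 ?(ltW mu_gt0) //.
  by rewrite ler_sqr ?nnegrE ?enorm_ge0 // (le_trans _ aD) ?enorm_ge0.
set s := iter _ _ _ in Ax xb *.
have [Ax' xb'] := inner_round_contraction (in_evals s) N0 NL Aa Ax zmin.
split=> //; rewrite [_ ^+ k.+1]exprS; move: ((1 / 2) ^+ k) xb => X xb.
by have := loss_growth zmin Ax; lra.
Qed.

Lemma in_evals_inner_round N x0 y1 e :
  in_evals (inner_round A phi p N (1 / L) t x0 y1 e) = (e + N)%N.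
Proof. by rewrite /inner_round; elim: N => [|N IH] /=; rewrite ?addn0 // IH addnS. Qed.

Lemma in_evals_inner_loop K N a e :
  in_evals (inner_loop A phi p K N (1 / L) t a e) = (e + N * (K %/ N).+1)%N.
Proof.
rewrite /inner_loop; elim: (K %/ N)%N => [|k IH] /=.
  by rewrite in_evals_inner_round muln1.
by rewrite in_evals_inner_round IH -addnA -mulnSr.
Qed.

(** Shrinking the move from [y] to [u] by [s = c / L] makes the model of curvature [L] at the
    shorter move at least [s] times the model of curvature [c] at [u]. The former is below a true
    decrease of the loss, hence below the gap. *)
Lemma prox_model_le_gap c y u z : 0 < c -> c <= L -> A y -> A u ->
  is_minimizer A loss z ->
  dot (grad_alpha phi t y) (u - y) - p u + p y - c / 2 * enorm (u - y) ^+ 2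
  <= L / c * (loss y - loss z).
Proof.
move=> c0 cL Ay Au [Az zmin]; pose s := c / L.
have s0 : 0 < s by rewrite divr_gt0.
have s1 : s <= 1 by rewrite ler_pdivrMr // mul1r.
have Ev := @sub_extrapolation _ _ A.
pose v := s *: u + (1 - s) *: y.
have Av : A v by apply: convex_setE => //; exact: ltW.
have vy : v - y = s *: (u - y) by apply/rowP => i; rewrite !mxE; ring.
have := phi_lower_model (Ev _ Ay) (Ev _ Av).
rewrite vy enorm_sqrZ dotZr => desc.
have pv := convex_function_strongly_convex p_convex Au Ay (ltW s0) s1.
rewrite !mul0r subr0 -/v in pv.
have lz : loss z <= loss v by exact: zmin.
rewrite -(ler_pM2l s0) (_ : s * (L / c * _) = loss y - loss z); last first.
  by rewrite /s; field; rewrite !gt_eqF.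
have sL : s * L = c by rewrite /s divfK ?gt_eqF.
have -> : c / 2 * enorm (u - y) ^+ 2 = s * L / 2 * enorm (u - y) ^+ 2 by rewrite sL.
by rewrite /loss in lz *; lra.
Qed.

End Inner.

(** * The outer loop *)

Lemma small_step_exists (R : realType) (v : nat -> R) (c : R) T :
  (0 < T)%N -> v 0%N - v T <= c ->
  exists2 k, (k < T)%N & T%:R * (v k - v k.+1) <= c.
Proof.
move=> T0 vc; apply/not_exists2P => all_big; move: vc; apply/negP; rewrite -ltNge.
have T0' : 0 < T%:R :> R by rewrite ltr0n.
have big k : (k < T)%N -> c / T%:R < v k - v k.+1.
  move=> kT; case: (all_big k) => // /negP; rewrite -ltNge => H.
  by rewrite ltr_pdivrMr // mulrC.
have : c / T%:R *+ T < \sum_(k < T) (v k - v k.+1).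
  rewrite -[X in _ *+ X]card_ord -sumr_const; apply: ltr_sum => //.
    by apply/hasP; exists (Ordinal T0); rewrite ?mem_index_enum.
  by move=> k _; exact: big.
rewrite -[X in X < _]mulr_natr divfK ?gt_eqF // => /lt_le_trans; apply.
rewrite -(big_mkord xpredT (fun k => v k - v k.+1)).
rewrite (eq_bigr (fun k => - (v k.+1 - v k))); last by move=> k _; rewrite opprB.
by rewrite sumrN telescope_sumr // opprB.
Qed.

Section Stationarity.
Context {R : realType} {m : nat}.
Implicit Types (S : set 'rV[R]_m) (g x : 'rV[R]_m) (q : 'rV[R]_m -> R).

(* The model of curvature c' at x + (c / c') (y - x) is at most c / c' times the
   model of curvature c at y. *)
Lemma scaled_model_decrease_le S q g x xp (c c' : R) :
  convex_set S -> compact S -> convex_function S q ->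
  {within S, continuous q} -> S x -> 0 <= c -> c <= c' -> 0 < c' ->
  is_minimizer S
    (fun y => dot g (y - x) + c' / 2 * enorm (y - x) ^+ 2 + q y) xp ->
  - (2 * c) * minval S
      (fun y => dot g (y - x) + q y - q x + c / 2 * enorm (y - x) ^+ 2)
  <= - (2 * c') *
     (dot g (xp - x) + c' / 2 * enorm (xp - x) ^+ 2 + q xp - q x).
Proof.
move=> cS kS cq contq Sx c0 cc' c'0 [Sxp xpmin].
have [c_eq0|cn0] := eqVneq c 0.
  rewrite c_eq0 mulr0 oppr0 mul0r.
  have := xpmin _ Sx; rewrite subrr dotr0 enorm0 expr0n mulr0 !add0r => xpq.
  by rewrite mulNr oppr_ge0 pmulr_rle0 ?mulr_gt0 // subr_le0.
have cp : 0 < c by rewrite lt_def cn0.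
rewrite /minval; set f := fun y => dot g (y - x) + q y - q x + _.
have [|Sy ymin] := @argminP _ _ S f (ex_intro _ _ Sx) kS.
  have -> : f = fun y => dot g (y - x) + c / 2 * enorm (y - x) ^+ 2 + (q y - q x).
    by apply/funext => y; rewrite /f; ring.
  by apply: model_continuous => y; apply: cvgB; [exact: contq|exact: cst_continuous].
set y := argmin S f in Sy ymin *; pose s := c / c'.
have s0 : 0 < s by rewrite divr_gt0.
have s1 : s <= 1 by rewrite ler_pdivrMr // mul1r.
have Sv := convex_setE cS Sy Sx (ltW s0) s1.
have qv := convex_function_strongly_convex cq Sy Sx (ltW s0) s1.
have := xpmin _ Sv; set v := _ + _ in Sv qv *.
have -> : v - x = s *: (y - x) by apply/rowP => i; rewrite !mxE; ring.
rewrite enorm_sqrZ dotZr => le1; rewrite !mul0r subr0 in qv.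
have sc : c = s * c' by rewrite /s divfK ?gt_eqF.
have key : dot g (xp - x) + c' / 2 * enorm (xp - x) ^+ 2 + q xp - q x <= s * f y.
  by rewrite /f [in X in _ <= X]sc; lra.
have -> : - (2 * c) * f y = - (2 * (c' * (s * f y))) by rewrite [in LHS]sc; ring.
by have := ler_wpM2l (ltW c'0) key; lra.
Qed.

End Stationarity.

(** * The regularized payoff and its partial gradients *)

Section PartialGradients.
Context {R : realType} {m n : nat}.
Context (h : 'rV[R]_m -> 'rV[R]_n -> R).
Implicit Types (t : 'rV[R]_m) (a ahat : 'rV[R]_n) (A : set 'rV[R]_n).
Hypothesis h_diff : forall z : 'rV[R]_m * 'rV[R]_n,
  differentiable (fun w => h w.1 w.2) z.

Lemma differentiable_section_r t a : differentiable (h t) a.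
Proof.
apply: (@differentiable_comp _ _ _ _ (fun b => (t, b)) (fun w => h w.1 w.2)).
  by apply: differentiable_pair; [exact: differentiable_cst|exact: ex_diff].
exact: h_diff.
Qed.

Lemma differentiable_section_l t a : differentiable (fun s => h s a) t.
Proof.
apply: (@differentiable_comp _ _ _ _ (fun s => (s, a)) (fun w => h w.1 w.2)).
  by apply: differentiable_pair; [exact: ex_diff|exact: differentiable_cst].
exact: h_diff.
Qed.

Lemma differentiable_regularized l ahat t a :
  differentiable (regularized h l ahat t) a.
Proof.
have -> : regularized h l ahat t =
    h t - (l / 2) *: (fun b => dot (b - ahat) (b - ahat)).
  by apply/funext => b; rewrite /regularized enorm_sqr.
apply: differentiableB; first exact: differentiable_section_r.
by apply: differentiableZ; exact: differentiable_sqdist.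
Qed.

Lemma grad_alpha_regularized l ahat t a :
  grad_alpha (regularized h l ahat) t a = grad_alpha h t a - l *: (a - ahat).
Proof.
rewrite /grad_alpha -/(regularized h l ahat t).
have -> : regularized h l ahat t =
    h t - (l / 2) *: (fun b => dot (b - ahat) (b - ahat)).
  by apply/funext => b; rewrite /regularized enorm_sqr.
have dh : differentiable (h t) a by exact: differentiable_section_r.
have ds := differentiable_sqdist ahat a.
apply/rowP => i; have := congr1 (fun v : 'rV[R]_n => v ord0 i) (gradient_sqdist ahat a).
rewrite !mxE => dsE; rewrite deriveB; first last.
- exact/diff_derivable/differentiableZ.
- exact: diff_derivable.
by rewrite deriveZ; [rewrite dsE /GRing.scale /=; field|exact: diff_derivable].
Qed.

Lemma grad_theta_regularized l ahat t a :
  grad_theta (regularized h l ahat) t a = grad_theta h t a.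
Proof.
apply/rowP => i; rewrite !mxE /derive; set g1 := fun e => _; set g2 := fun e => _.
suff -> : g1 = g2 by [].
by apply/funext => e; rewrite /g1 /g2 /= /regularized; congr (_ *: _); ring.
Qed.

Lemma regularized_strongly_concave A l ahat t :
  convex_function (extrapolation A) (fun a => - h t a) ->
  strongly_convex (extrapolation A) l (fun a => - regularized h l ahat t a).
Proof.
move=> ch; have -> : (fun a => - regularized h l ahat t a) =
    (fun a => - h t a + (dot 0 (a - ahat) + l / 2 * enorm (a - ahat) ^+ 2)).
  by apply/funext => a; rewrite /regularized dotC dotr0; ring.
rewrite -[l in strongly_convex _ l _]add0r; apply: strongly_convexD.
  exact: convex_function_strongly_convex.
exact: strongly_convex_model.
Qed.

End PartialGradients.

(** * Descent of the inner maximum and the two stationarity criteria *)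

Section Outer.
Context {R : realType} {m n : nat}.
Context (Theta : set 'rV[R]_m) (A : set 'rV[R]_n).
Context (h : 'rV[R]_m -> 'rV[R]_n -> R) (p : 'rV[R]_n -> R) (q : 'rV[R]_m -> R).
Context (L11 L12 L22 rad lambda : R) (ahat : 'rV[R]_n) (K N : nat).
Hypotheses (Theta_convex : convex_set Theta) (Theta_compact : compact Theta).
Hypotheses (A_convex : convex_set A) (A_compact : compact A).
Hypothesis Theta_diam : forall t1 t2, Theta t1 -> Theta t2 ->
  enorm (t1 - t2) <= 2 * rad.
Hypothesis A_diam : forall a1 a2, A a1 -> A a2 -> enorm (a1 - a2) <= 2 * rad.
Hypothesis h_diff : forall z : 'rV[R]_m * 'rV[R]_n,
  differentiable (fun w => h w.1 w.2) z.
Hypotheses (p_convex : convex_function A p).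
Hypothesis p_continuous : {within A, continuous p}.
Hypothesis q_convex : convex_function Theta q.
Hypothesis q_continuous : {within Theta, continuous q}.
Hypotheses (L11_ge0 : 0 <= L11) (L12_ge0 : 0 <= L12).
Hypotheses (L11_L12_gt0 : 0 < L11 + L12) (L22_gt0 : 0 < L22).
Hypothesis h_L11 : forall t1 t2 a, Theta t1 -> Theta t2 -> A a ->
  enorm (grad_theta h t1 a - grad_theta h t2 a) <= L11 * enorm (t1 - t2).
Hypothesis h_L22 : forall t a1 a2, Theta t ->
  extrapolation A a1 -> extrapolation A a2 ->
  enorm (grad_alpha h t a1 - grad_alpha h t a2) <= L22 * enorm (a1 - a2).
Hypothesis h_L21 : forall t a1 a2, Theta t -> A a1 -> A a2 ->
  enorm (grad_theta h t a1 - grad_theta h t a2) <= L12 * enorm (a1 - a2).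
Hypothesis h_concave : forall t, Theta t ->
  convex_function (extrapolation A) (fun a => - h t a).
Hypothesis ahat_in : A ahat.
Hypotheses (lambda_gt0 : 0 < lambda) (lambda_le : lambda <= L22).
Hypotheses (N_gt0 : (0 < N)%N)
  (N_large : 8 * (L22 + lambda) <= lambda * N.+1%:R ^+ 2).

Implicit Types (t : 'rV[R]_m) (a : 'rV[R]_n).

Let phi := regularized h lambda ahat.
Let Lg := L11 + L12 ^+ 2 / lambda.
Let L := L22 + lambda.
Let lossphi := loss phi p.
Let best t := argmin A (lossphi t).
(** The bound of [inner_loop_bound] with [mu = lambda] and [D = 2 * rad]. *)
Let gap0 := lambda * rad ^+ 2 * (1 / 2) ^+ (K %/ N)%N.

Let L_gt0 : 0 < L.
Proof. by rewrite addr_gt0. Qed.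

Let Lg_gt0 : 0 < Lg.
Proof.
have [L120|L12n0] := eqVneq L12 0.
  by rewrite /Lg L120 expr0n mul0r addr0; move: L11_L12_gt0; rewrite L120 addr0.
by rewrite ltr_wpDl // divr_gt0 // exprn_even_gt0.
Qed.

Lemma phi_lipschitz t a1 a2 : Theta t -> extrapolation A a1 -> extrapolation A a2 ->
  enorm (grad_alpha phi t a1 - grad_alpha phi t a2) <= L * enorm (a1 - a2).
Proof.
move=> Tt E1 E2; rewrite !grad_alpha_regularized //.
rewrite (_ : _ - _ - _ = grad_alpha h t a1 - grad_alpha h t a2 + - lambda *: (a1 - a2)).
  apply: le_trans (enormD _ _) _; rewrite mulrDl lerD ?h_L22 //.
  by rewrite enormZ normrN gtr0_norm.
by apply/rowP => i; rewrite !mxE; ring.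
Qed.

Lemma best_minimizer t : is_minimizer A (lossphi t) (best t).
Proof.
apply: argminP => //; first by exists ahat.
move=> a; apply: cvgB; first exact: p_continuous.
have cphi : continuous (phi t).
  by move=> b; exact/differentiable_continuous/differentiable_regularized.
exact: (continuous_subspaceT cphi).
Qed.

Lemma lossphi_growth t a : Theta t -> A a ->
  lambda / 2 * enorm (a - best t) ^+ 2 <= lossphi t a - lossphi t (best t).
Proof.
move=> Tt Aa; apply: loss_growth Aa => //.
  by apply: regularized_strongly_concave; exact: h_concave.
exact: best_minimizer.
Qed.

Definition value t := q t - lossphi t (best t).

(* The Lipschitz constant of the gradient of the inner maximum, without
   differentiating it: the quadratic growth of the loss at best t absorbs, by
   Young's inequality, the drift of the maximizer. *)
Lemma value_descent t t' a : Theta t -> Theta t' -> A a ->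
  value t' <= value t + (dot (grad_theta h t a) (t' - t)
     + Lg / 2 * enorm (t' - t) ^+ 2 + q t' - q t)
     + L12 * enorm (a - best t) * enorm (t' - t).
Proof.
move=> Tt Tt' Aa; have [Ab bmin] := best_minimizer t.
have [Ab' _] := best_minimizer t'.
set d := t' - t.
(* The smooth part is followed at the new maximizer [best t'], where [value t'] is attained. Its
   gradient is then exchanged for the one at [best t] ([c1]) and next for the one at [a] that the
   algorithm uses ([c2]). *)
have desc := descent_lemma Theta_convex
  (fun z _ => differentiable_section_l h_diff z (best t'))
  (fun z1 z2 T1 T2 => h_L11 T1 T2 Ab') Tt Tt'.
have grow := lossphi_growth Tt Ab'.
pose g b := grad_theta h t b.
have c1 : dot (g (best t') - g (best t)) d <=
    lambda / 2 * enorm (best t' - best t) ^+ 2 + L12 ^+ 2 / lambda / 2 * enorm d ^+ 2.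
  apply: le_trans (cauchy_schwarz _ _) _.
  apply: le_trans (ler_wpM2r (enorm_ge0 d) (h_L21 Tt Ab' Ab)) _.
  set x := enorm (_ - _); set y := enorm d.
  have : 0 <= (lambda * x - L12 * y) ^+ 2 / (2 * lambda).
    by rewrite divr_ge0 ?sqr_ge0 ?mulr_ge0 // ltW.
  have -> : (lambda * x - L12 * y) ^+ 2 / (2 * lambda) =
      lambda / 2 * x ^+ 2 + L12 ^+ 2 / lambda / 2 * y ^+ 2 - L12 * x * y.
    by field; rewrite gt_eqF.
  by rewrite subr_ge0.
have c2 : dot (g (best t) - g a) d <= L12 * enorm (a - best t) * enorm d.
  apply: le_trans (cauchy_schwarz _ _) _; rewrite ler_wpM2r ?enorm_ge0 //.
  by rewrite enormBC; exact: h_L21.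
have gE : gradient (h^~ (best t')) t = g (best t') by [].
rewrite gE -/d in desc; rewrite !dotDl !dotNl in c1 c2.
rewrite /value /Lg -/(g a).
rewrite /lossphi /loss /phi /regularized in grow *.
lra.
Qed.

Lemma prox_theta_minimizer t a : Theta t ->
  is_minimizer Theta (fun y => dot (grad_theta h t a) (y - t)
    + Lg / 2 * enorm (y - t) ^+ 2 + q y) (prox_theta Theta phi q t a Lg^-1).
Proof.
move=> Tt; have -> : prox_theta Theta phi q t a Lg^-1 = argmin Theta
    (fun y => dot (grad_theta h t a) (y - t) + Lg / 2 * enorm (y - t) ^+ 2 + q y).
  congr (argmin Theta _); apply/funext => y; rewrite grad_theta_regularized.
  by rewrite (_ : 1 / (2 * Lg^-1) = Lg / 2) //; field; rewrite gt_eqF ?Lg_gt0.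
by apply: argminP => //; [exists t|exact: model_continuous].
Qed.

(* Young's inequality moves the regularization term lambda (a - ahat) of the
   gradient into 3/4 of the quadratic term; the rest is controlled by the gap. *)
Lemma statY_le t a : Theta t -> A a ->
  statY A h p L22 t a <= 16 * L22 * (lossphi t a - lossphi t (best t))
                         + 16 / 3 * (lambda ^+ 2 * rad ^+ 2).
Proof.
move=> Tt Aa; rewrite /statY /maxval; set f := fun a' => dot _ (a' - a) - _ + _ - _.
have [|Ab _] := @argmaxP _ _ A f (ex_intro _ _ Aa) A_compact.
  have -> : f = fun b => - (dot (- grad_alpha h t a) (b - a)
      + L22 / 2 * enorm (b - a) ^+ 2 + (p b - p a)).
    by apply/funext => b; rewrite /f dotNl; ring.
  move=> b; apply: cvgN; apply: model_continuous => {}b.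
  by apply: cvgB; [exact: p_continuous|exact: cst_continuous].
set b := argmax A f in Ab *.
(* Curvature [L22 / 4] is what Young's inequality leaves, and [L <= 2 * L22] bounds [L / (L22 / 4)]
   by 8. An even split would cost [8 * lambda ^+ 2 * rad ^+ 2], which may be all of [eps ^+ 2]; the
   share 3/4 leaves a third of it for the gap. *)
have c0 : 0 < L22 / 4 by rewrite divr_gt0.
have cL : L22 / 4 <= L by rewrite /L; move: lambda_gt0 L22_gt0; lra.
have := prox_model_le_gap A_convex L_gt0 p_convex
  (differentiable_regularized h_diff _ _ _)
  (fun a1 a2 => phi_lipschitz Tt) c0 cL Aa Ab (best_minimizer t).
rewrite -/lossphi grad_alpha_regularized //.
have gap_ge0 : 0 <= lossphi t a - lossphi t (best t).
  by rewrite subr_ge0; have [_] := best_minimizer t; apply.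
have L8 : L / (L22 / 4) <= 8.
  by rewrite ler_pdivrMr // /L; move: lambda_le; lra.
have := ler_wpM2r gap_ge0 L8.
have c34 : 0 < 3 / 4 * L22 by rewrite mulr_gt0.
have := dot_young (b - a) (lambda *: (a - ahat)) c34.
rewrite enorm_sqrZ [dot (b - a) _]dotC.
have aR : enorm (a - ahat) ^+ 2 <= 4 * rad ^+ 2.
  have := A_diam Aa ahat_in => aR.
  have -> : 4 * rad ^+ 2 = (2 * rad) ^+ 2 by ring.
  by rewrite ler_sqr ?nnegrE ?enorm_ge0 // (le_trans _ aR) ?enorm_ge0.
have := ler_wpM2l (sqr_ge0 lambda) aR.
set X := lambda ^+ 2 * enorm _ ^+ 2 => XR.
have -> : X / (2 * (3 / 4 * L22)) = (2 / 3 * X) / L22.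
  by field; rewrite gt_eqF.
rewrite !dotDl !dotNl.
move: (lossphi t a - _) gap_ge0 => gap gap_ge0 H1 H2 H3.
have fb : f b <= 8 * gap + (2 / 3 * X) / L22.
  rewrite /f; lra.
have := ler_wpM2l (ltW L22_gt0) fb.
have -> : L22 * (8 * gap + 2 / 3 * X / L22) = 8 * L22 * gap + 2 / 3 * X.
  by field; rewrite gt_eqF.
rewrite -[dot _ _ - _ + _ - _]/(f b); move: (f b) X XR {H1 H3 fb} => fb X XR; lra.
Qed.

(** Both values are compared at [best t], where [p] and the regularizer cancel; the same [D] thus
    serves for every [eps]. *)
Lemma value_osc_le D t t' : (forall a, A a -> q t - q t' + h t a - h t' a <= D) ->
  value t - value t' <= D.
Proof.
move=> hD; have [Ab _] := best_minimizer t; have [_ bmin] := best_minimizer t'.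
have := bmin _ Ab; have := hD _ Ab.
rewrite /value /lossphi /loss /phi /regularized; lra.
Qed.

Context (theta0 : 'rV[R]_m) (alpha0 : 'rV[R]_n).
Hypotheses (theta0_in : Theta theta0) (alpha0_in : A alpha0).

Let run k := MAPGDA Theta A phi p q K N (1 / L) Lg^-1 theta0 alpha0 k.

Lemma MAPGDA_step k :
  [/\ Theta (out_theta (run k)), A (out_alpha (run k)), A (out_alpha (run k.+1)),
      out_theta (run k.+1) = prox_theta Theta phi q (out_theta (run k))
                               (out_alpha (run k.+1)) Lg^-1 &
      lossphi (out_theta (run k)) (out_alpha (run k.+1))
      - lossphi (out_theta (run k)) (best (out_theta (run k))) <= gap0].
Proof.
have step s : Theta (out_theta s) -> A (out_alpha s) ->
    let a := in_x (inner_loop A phi p K N (1 / L) (out_theta s) (out_alpha s)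
                     (out_evals s)) in
    A a /\ lossphi (out_theta s) a - lossphi (out_theta s) (best (out_theta s)) <= gap0.
  move=> Ts As.
  have /= [Ax xb] := inner_loop_bound A_convex A_compact L_gt0
    lambda_gt0 p_convex p_continuous (differentiable_regularized h_diff _ _ _)
    (fun a1 a2 => phi_lipschitz Ts)
    (regularized_strongly_concave lambda ahat (h_concave Ts))
    K (out_evals s) N_gt0 N_large As (best_minimizer _)
    (A_diam As (proj1 (best_minimizer _))).
  split=> //; apply: le_trans xb _; rewrite /gap0.
  by move: ((1 / 2) ^+ _) => X; rewrite le_eqVlt; apply/orP; left; apply/eqP; field.
have inv j : Theta (out_theta (run j)) /\ A (out_alpha (run j)).
  elim: j => [//|j [Tj Aj]]; have [Ax _] := step _ Tj Aj.
  by split=> //; exact: (proj1 (prox_theta_minimizer _ Tj)).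
have [Tk Ak] := inv k; have [Ax xb] := step _ Tk Ak.
by split.
Qed.

(** [del] bounds the distance of alpha_{t+1} to the inner maximizer. In the theta criterion the
    averaged decrease and the inner error each get half of [eps ^+ 2]; in the alpha criterion the
    regularization gets 2/3 and the gap 1/3. *)
Lemma MAPGDA_finds_NE D del eps T : (0 < T)%N ->
  (forall t t' a, Theta t -> Theta t' -> A a -> q t - q t' + h t a - h t' a <= D) ->
  0 <= del -> 2 * rad ^+ 2 * (1 / 2) ^+ (K %/ N)%N <= del ^+ 2 ->
  8 * Lg * L12 * rad * del <= eps ^+ 2 ->
  4 * Lg * D <= eps ^+ 2 * T%:R ->
  8 * lambda ^+ 2 * rad ^+ 2 <= eps ^+ 2 ->
  48 * L22 * gap0 <= eps ^+ 2 ->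
  exists2 k, (k < T)%N &
    first_order_NE Theta A h p q L11 L22 eps
      (out_theta (run k)) (out_alpha (run k.+1)).
Proof.
move=> T0 hD del0 delE Edel ET Elam Egap.
have [|k kT vk] := small_step_exists (v := fun k => value (out_theta (run k)))
    (c := D) T0.
  apply: value_osc_le => a Aa; apply: hD => //.
  by have [] := MAPGDA_step T.
exists k => //; have [Tt _ Aa tE gapk] := MAPGDA_step k.
set t := out_theta (run k) in vk Tt tE gapk *.
set a := out_alpha (run k.+1) in Aa tE gapk *.
have pmin := prox_theta_minimizer a Tt; rewrite -tE in pmin.
set t' := out_theta (run k.+1) in vk tE pmin.
have Tt' : Theta t' by case: pmin.
have adel : enorm (a - best t) <= del.
  rewrite enorm_le //; apply: le_trans delE.
  (* The factor [lambda] of [gap0] cancels against that of the quadratic growth, so the distance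
     bound does not deteriorate as [lambda] shrinks. *)
  have := le_trans (lossphi_growth Tt Aa) gapk; rewrite /gap0.
  move=> H; rewrite -(ler_pM2l (_ : 0 < lambda / 2)) ?divr_gt0 //.
  by apply: le_trans H _; move: ((1 / 2) ^+ _) => X; lra.
split => //.
  have LgL11 : L11 <= Lg by rewrite lerDl divr_ge0 ?sqr_ge0 // ltW.
  have := scaled_model_decrease_le Theta_convex Theta_compact q_convex q_continuous
    Tt L11_ge0 LgL11 Lg_gt0 pmin.
  move/le_trans; apply.
  have := value_descent Tt Tt' Aa.
  have : L12 * enorm (a - best t) * enorm (t' - t) <= L12 * del * (2 * rad).
    by apply: ler_pM; rewrite ?mulr_ge0 ?enorm_ge0 ?Theta_diam // ler_wpM2l.
  set M := dot _ _ + _ + _ - _ => H1 H2.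
  have H3 : - M <= value t - value t' + L12 * del * (2 * rad) by lra.
  have T0' : 0 < T%:R :> R by rewrite ltr0n.
  have H4 : value t - value t' <= D / T%:R by rewrite ler_pdivlMr // mulrC.
  have H5 : 4 * Lg * (D / T%:R) <= eps ^+ 2 by rewrite mulrA ler_pdivrMr.
  have := ler_wpM2l (ltW Lg_gt0) H3; have := ler_wpM2l (ltW Lg_gt0) H4; lra.
apply: le_trans (statY_le Tt Aa) _.
have := ler_wpM2l (ltW L22_gt0) gapk; lra.
Qed.

End Outer.

(** * Choice of the parameters *)

Section Calibration.
Context {R : realType}.


Lemma reg_weight_gt0 (L22 rad eps : R) : 0 < L22 -> 0 < rad -> 0 < eps ->
  0 < reg_weight L22 rad eps.
Proof.
by move=> L0 r0 e0; rewrite lt_min L0 divr_gt0 ?mulr_gt0 ?sqrtr_gt0.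
Qed.

Lemma reg_weight_le (L22 rad eps : R) : reg_weight L22 rad eps <= L22.
Proof. by rewrite ge_min lexx. Qed.

Lemma reg_weight_bias (L22 rad eps : R) : 0 < L22 -> 0 < rad -> 0 < eps ->
  8 * reg_weight L22 rad eps ^+ 2 * rad ^+ 2 <= eps ^+ 2.
Proof.
move=> L0 r0 e0; have l0 := reg_weight_gt0 L0 r0 e0.
have c0 : 0 < 2 * Num.sqrt 2 * rad by rewrite !mulr_gt0 ?sqrtr_gt0.
have : reg_weight L22 rad eps <= eps / (2 * Num.sqrt 2 * rad).
  by rewrite ge_min lexx orbT.
rewrite ler_pdivlMr //; set l := reg_weight _ _ _ in l0 *; move=> bound.
have : (l * (2 * Num.sqrt 2 * rad)) ^+ 2 <= eps ^+ 2.
  by rewrite ler_sqr ?nnegrE //; apply/ltW => //; exact: mulr_gt0.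
by rewrite !exprMn sqr_sqrtr //; lra.
Qed.

(** The inverse of a minimum is at most the sum of the inverses. The power of [eps^-1 + 1] makes the
    bound valid for every positive [eps], as the equilibrium claim requires. *)
Lemma reg_weight_inv_le (L22 rad eps : R) : 0 < L22 -> 0 < rad -> 0 < eps ->
  (reg_weight L22 rad eps)^-1 <=
  (L22^-1 + 2 * Num.sqrt 2 * rad) * (eps^-1 + 1).
Proof.
move=> L0 r0 e0; have c0 : 0 < 2 * Num.sqrt 2 * rad by rewrite !mulr_gt0 ?sqrtr_gt0.
have Li0 : 0 < L22^-1 by rewrite invr_gt0.
have ei0 : 0 < eps^-1 by rewrite invr_gt0.
have := mulr_gt0 Li0 ei0; have := mulr_gt0 c0 ei0.
rewrite /reg_weight minEle; case: ifP => _; last rewrite invf_div; lra.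
Qed.

Lemma inner_length_gt0 (L22 lambda : R) : 0 < lambda -> lambda <= L22 ->
  (0 < inner_length L22 lambda)%N.
Proof.
move=> l0 lL; rewrite absz_gt0 ceil_neq0; apply/orP; right.
rewrite subr_gt0 -[ltLHS]sqrtr1 ltr_sqrt; last first.
  by rewrite divr_gt0 // mulr_gt0 // addr_gt0 // (lt_le_trans l0).
by rewrite ltr_pdivlMr // mul1r; lra.
Qed.

Lemma inner_lengthE (L22 lambda : R) : 0 < lambda -> lambda <= L22 ->
  (inner_length L22 lambda)%:R
  = (Num.ceil (Num.sqrt (8 * (L22 + lambda) / lambda) - 1))%:~R :> R.
Proof.
move=> l0 lL; rewrite /inner_length pmulrn gez0_abs //.
rewrite ceil_ge0 ltrBrDl subrr sqrtr_gt0.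
by rewrite divr_gt0 // mulr_gt0 // addr_gt0 // (lt_le_trans l0).
Qed.

Lemma inner_length_large (L22 lambda : R) : 0 < lambda -> lambda <= L22 ->
  8 * (L22 + lambda) <= lambda * (inner_length L22 lambda).+1%:R ^+ 2.
Proof.
move=> l0 lL; rewrite [leRHS]mulrC -ler_pdivrMr //.
have k0 : 0 <= 8 * (L22 + lambda) / lambda.
  by rewrite ltW // divr_gt0 // mulr_gt0 // addr_gt0 // (lt_le_trans l0).
rewrite -[leLHS]sqr_sqrtr // ler_sqr ?nnegrE ?sqrtr_ge0 //.
by rewrite -[leRHS]natr1 inner_lengthE // -lerBlDr; exact: ceil_ge.
Qed.

(** The [- 1] in the round length absorbs the rounding up, since ceil (x - 1) < x. *)
Lemma inner_length_le (L22 lambda : R) : 0 < lambda -> lambda <= L22 ->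
  (inner_length L22 lambda)%:R <= Num.sqrt (16 * L22 / lambda).
Proof.
move=> l0 lL; rewrite inner_lengthE //.
have /andP[] := ceil_itv (Num.sqrt (8 * (L22 + lambda) / lambda) - 1).
rewrite intrB ltrBlDr subrK => /ltW/le_trans le1 _; apply: le1.
rewrite ler_wsqrtr // ler_pM2r ?invr_gt0 //; lra.
Qed.

Lemma le_pow2 (y : R) r : 0 < y -> ln y / ln 2 <= r%:R -> y <= 2 ^+ r.
Proof.
have l2 : 0 < ln (2 : R) by apply: ln_gt0; rewrite ltr1n.
move=> y0; rewrite ler_pdivrMr // => yr.
rewrite -[leLHS]lnK ?posrE // -[2 in leRHS]lnK ?posrE // -expRM_natl.
by rewrite ler_expR.
Qed.

Lemma eqO_at_right0 (f g : R -> R) k e0 : 0 < e0 ->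
  (forall eps, 0 < eps -> eps < e0 -> `|f eps| <= k * g eps) ->
  f =O_ (0^'+) g.
Proof.
move=> e00 fg; apply/eqO_exP; exists (`|k| + 1); first by rewrite ltr_wpDl.
near=> eps; have eps0 : 0 < eps by near: eps; exact: nbhs_right_gt.
have eps1 : eps < e0 by near: eps; exact: nbhs_right_lt.
apply: le_trans (fg _ eps0 eps1) _; apply: le_trans (ler_norm _) _.
by rewrite normrM ler_wpM2r // lerDl.
Unshelve. all: by end_near. Qed.

End Calibration.

Lemma MAPGDA_evals (R : realType) m n (Theta : set 'rV[R]_m) (A : set 'rV[R]_n)
    phi p q K N L eta2 theta0 alpha0 T :
  out_evals (MAPGDA Theta A phi p q K N (1 / L) eta2 theta0 alpha0 T)
  = (T * (N * (K %/ N).+1).+1)%N.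
Proof.
rewrite /MAPGDA; elim: T => [//|T IH] /=.
by rewrite in_evals_inner_loop IH mulSn addnC addSn.
Qed.

Lemma compact_oscillation (R : realType) m n (Theta : set 'rV[R]_m)
    (A : set 'rV[R]_n) (h : 'rV[R]_m -> 'rV[R]_n -> R) (q : 'rV[R]_m -> R) :
  compact Theta -> compact A -> A !=set0 ->
  continuous (fun w : 'rV[R]_m * 'rV[R]_n => h w.1 w.2) ->
  {within Theta, continuous q} ->
  exists2 D, 0 <= D & forall t t' a, Theta t -> Theta t' -> A a ->
    q t - q t' + h t a - h t' a <= D.
Proof.
move=> cT cA [a0 Aa0] ch cq.
have [[t0 Tt0]|T0] := pselect (Theta !=set0); last first.
  by exists 0 => // t t' a Tt; case: T0; exists t.
have TA0 : Theta `*` A !=set0 by exists (t0, a0).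
have cTA := compact_setX cT cA.
have [w1 _ h1] := compact_EVT_max TA0 cTA (continuous_subspaceT ch).
have [w2 _ h2] := compact_EVT_min TA0 cTA (continuous_subspaceT ch).
have [t1 _ q1] := compact_EVT_max (ex_intro _ _ Tt0) cT cq.
have [t2 _ q2] := compact_EVT_min (ex_intro _ _ Tt0) cT cq.
exists (`|q t1 - q t2 + h w1.1 w1.2 - h w2.1 w2.2|) => // t t' a Tt Tt' Aa.
apply: le_trans (ler_norm _).
have /= := h1 (t, a) (mem_set (conj Tt Aa)).
have /= := h2 (t', a) (mem_set (conj Tt' Aa)).
have := q1 _ (mem_set Tt); have := q2 _ (mem_set Tt').
lra.
Qed.

(** * Growth rates for small [eps] *)

Section Growth.
Context {R : realType}.
Implicit Types eps c : R.

(** Below 1/e the logarithm is at least 1, so additive constants can be absorbed into it. *)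
Lemma ln_inv_ge1 eps : 0 < eps -> eps < expR (-1) -> eps <= 1 /\ 1 <= ln eps^-1.
Proof.
move=> e0 e1; have leps : ln eps <= -1.
  by rewrite -[leRHS]expRK ler_ln ?posrE ?expR_gt0 ?ltW.
split; last by rewrite lnV ?posrE // lerNr.
by rewrite -ler_ln ?posrE // ln1 (le_trans leps) // lerN10.
Qed.

Lemma inv_succ_le eps : 0 < eps -> eps <= 1 -> eps^-1 + 1 <= 2 * eps^-1.
Proof. by move=> e0 e1; have : 1 <= eps^-1 by [rewrite invf_ge1]; lra. Qed.

Lemma truncn_cube_le c eps : 0 <= c -> 0 < eps -> eps <= 1 ->
  (Num.truncn (c * (eps^-1 + 1) ^+ 3)).+1%:R <= 8 * (c + 1) * eps ^- 3.
Proof.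
move=> c0 e0 e1; have u2 := inv_succ_le e0 e1.
have i0 : 0 < eps^-1 by rewrite invr_gt0.
have u0 : 0 <= eps^-1 + 1 by lra.
have x0 : 0 <= c * (eps^-1 + 1) ^+ 3 by rewrite mulr_ge0 // exprn_ge0.
have /andP[tx _] := truncn_itv x0.
rewrite -natr1; apply: le_trans (lerD tx (lexx 1)) _.
have u3 : (eps^-1 + 1) ^+ 3 <= 8 * eps ^- 3.
  rewrite -exprVn (_ : 8 * _ = (2 * eps^-1) ^+ 3); last by ring.
  by rewrite lerXn2r ?nnegrE // mulr_ge0 // ltW.
have e3 : 1 <= eps ^- 3 by rewrite -exprVn exprn_ege1 // invf_ge1.
have := ler_wpM2l c0 u3; lra.
Qed.

Lemma truncn_log_le c eps : 1 <= c -> 0 < eps -> eps <= 1 -> 1 <= ln eps^-1 ->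
  (Num.truncn (ln (c * (eps^-1 + 1) ^+ 6) / ln 2)).+1%:R <=
  ((ln c + 6 * ln 2 + 6) / ln 2 + 1) * ln eps^-1.
Proof.
move=> c1 e0 e1 l1; have u2 := inv_succ_le e0 e1.
have ln2 : 0 < ln (2 : R) by apply: ln_gt0; rewrite ltr1n.
have i0 : 0 < eps^-1 by rewrite invr_gt0.
have u0 : 0 < eps^-1 + 1 by lra.
have c0 : 0 < c by lra.
have lc : 0 <= ln c by exact: ln_ge0.
have lE : ln (c * (eps^-1 + 1) ^+ 6) = ln c + 6 * ln (eps^-1 + 1).
  by rewrite lnM ?posrE ?exprn_gt0 // lnXn // mulr_natl.
have lu : ln (eps^-1 + 1) <= ln 2 + ln eps^-1.
  by rewrite -lnM ?posrE // ler_ln ?posrE ?mulr_gt0.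
have lu0 : 0 <= ln (eps^-1 + 1) by apply: ln_ge0; lra.
have x0 : 0 <= ln (c * (eps^-1 + 1) ^+ 6) / ln 2.
  by rewrite divr_ge0 ?(ltW ln2) // lE; lra.
have /andP[tx _] := truncn_itv x0.
rewrite -natr1 mulrDl mul1r; apply: (lerD _ l1).
apply: le_trans tx _; rewrite mulrAC ler_pM2r ?invr_gt0 // lE.
have := ler_wpM2l lc l1; have := ler_wpM2l (ltW ln2) l1; lra.
Qed.

Lemma powR_half_sqr eps : 0 < eps -> (eps `^ (- (1 / 2))) ^+ 2 = eps^-1.
Proof.
move=> e0; rewrite expr2 -powRD; last by rewrite (gt_eqF e0) implybT.
by rewrite (_ : _ + _ = -1) ?powR_inv1 ?ltW //; field.
Qed.

Lemma powR_7half eps : 0 < eps ->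
  eps `^ (- (7 / 2)) = eps ^- 3 * eps `^ (- (1 / 2)).
Proof.
move=> e0; rewrite -powR_invn ?ltW // -powRD; last by rewrite (gt_eqF e0) implybT.
by congr (_ `^ _); field.
Qed.

Lemma inner_length_reg_weight_le (L22 rad eps : R) : 0 < L22 -> 0 < rad ->
  0 < eps -> eps <= 1 ->
  (inner_length L22 (reg_weight L22 rad eps))%:R <=
  Num.sqrt (32 * L22 * (L22^-1 + 2 * Num.sqrt 2 * rad)) * eps `^ (- (1 / 2)).
Proof.
move=> L0 r0 e0 e1; have l0 := reg_weight_gt0 L0 r0 e0.
apply: le_trans (inner_length_le l0 (reg_weight_le _ _ _)) _.
set c := _ + _; have c0 : 0 < c by rewrite addr_gt0 ?invr_gt0 ?mulr_gt0 ?sqrtr_gt0.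
rewrite -[eps `^ _]ger0_norm ?powR_ge0 // -sqrtr_sqr powR_half_sqr //.
have k0 : 0 <= 32 * L22 * c by rewrite ltW // !mulr_gt0.
rewrite -sqrtrM // ler_wsqrtr //.
have u2 := inv_succ_le e0 e1.
have li := reg_weight_inv_le L0 r0 e0.
have := ler_wpM2l (ltW c0) u2; rewrite -/c in li => cu.
have := le_trans li cu => lc.
by have := ler_wpM2l (ltW L0) lc; lra.
Qed.

End Growth.

Theorem corollary2 (R : realType) (m n : nat)
  (Theta : set 'rV[R]_m) (A : set 'rV[R]_n)
  (h : 'rV[R]_m -> 'rV[R]_n -> R) (p : 'rV[R]_n -> R) (q : 'rV[R]_m -> R)
  (L11 L12 L22 Lp rad : R)
  (Theta_convex : convex_set Theta) (Theta_compact : compact Theta)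
  (A_convex : convex_set A) (A_compact : compact A)
  (rad_gt0 : 0 < rad)
  (Theta_ball : exists c, forall t, Theta t -> enorm (t - c) <= rad)
  (A_ball : exists c, forall a, A a -> enorm (a - c) <= rad)
  (h_C1 : C1 h)
  (p_convex : convex_function A p)
  (p_lipschitz : forall a1 a2, A a1 -> A a2 ->
     `|p a1 - p a2| <= Lp * enorm (a1 - a2))
  (q_convex : convex_function Theta q)
  (q_continuous : {within Theta, continuous q})
  (L11_ge0 : 0 <= L11) (L12_ge0 : 0 <= L12)
  (L11_L12_gt0 : 0 < L11 + L12) (L22_gt0 : 0 < L22)
  (h_L11 : forall t1 t2 a, Theta t1 -> Theta t2 -> A a ->
     enorm (grad_theta h t1 a - grad_theta h t2 a) <= L11 * enorm (t1 - t2))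
  (h_L22 : forall t a1 a2, Theta t -> extrapolation A a1 -> extrapolation A a2 ->
     enorm (grad_alpha h t a1 - grad_alpha h t a2) <= L22 * enorm (a1 - a2))
  (h_L12 : forall t1 t2 a, Theta t1 -> Theta t2 -> A a ->
     enorm (grad_alpha h t1 a - grad_alpha h t2 a) <= L12 * enorm (t1 - t2))
  (h_L21 : forall t a1 a2, Theta t -> A a1 -> A a2 ->
     enorm (grad_theta h t a1 - grad_theta h t a2) <= L12 * enorm (a1 - a2))
  (h_concave : forall t, Theta t ->
     convex_function (extrapolation A) (fun a => - h t a))
  (ahat : 'rV[R]_n) (ahat_in : A ahat) :
  let lambda eps := reg_weight L22 rad eps in
  exists T K : R -> nat,
  let run eps theta0 alpha0 :=
    MAPGDA Theta A (regularized h (lambda eps) ahat) p q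
      (K eps) (inner_length L22 (lambda eps))
      (step_alpha L22 (lambda eps)) (step_theta L11 L12 (lambda eps))
      theta0 alpha0 in
  [/\ (fun eps => (T eps)%:R : R) =O_ (0^'+) (fun eps => eps ^- 3),
      (fun eps => (K eps)%:R : R) =O_ (0^'+)
        (fun eps => eps `^ (- (1 / 2)) * ln (eps^-1)) &
      forall theta0 alpha0, Theta theta0 -> A alpha0 ->
        (fun eps => (out_evals (run eps theta0 alpha0 (T eps)))%:R : R)
          =O_ (0^'+) (fun eps => eps `^ (- (7 / 2)) * ln (eps^-1)) /\
        forall eps, 0 < eps -> exists2 t : nat, (t < T eps)%N &
          first_order_NE Theta A h p q L11 L22 eps
            (out_theta (run eps theta0 alpha0 t))
            (out_alpha (run eps theta0 alpha0 t.+1))].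

Proof.
move=> lambda; have [h_diff _ _] := h_C1.
have h_cont : continuous (fun w : 'rV[R]_m * 'rV[R]_n => h w.1 w.2).
  by move=> w; exact/differentiable_continuous/h_diff.
have [D D0 hD] := compact_oscillation Theta_compact A_compact
  (ex_intro _ _ ahat_in) h_cont q_continuous.
have p_cont := lipschitz_within_continuous p_lipschitz.
have Theta_diam t1 t2 : Theta t1 -> Theta t2 -> enorm (t1 - t2) <= 2 * rad.
  by have [c Tc] := Theta_ball => /Tc T1 /Tc T2; exact: enorm_ball T1 T2.
have A_diam a1 a2 : A a1 -> A a2 -> enorm (a1 - a2) <= 2 * rad.
  by have [c Ac] := A_ball => /Ac A1 /Ac A2; exact: enorm_ball A1 A2.
(* With u = 1/eps + 1, [c1 * u] bounds 1 / lambda and [c2 * u] bounds Lg. *)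
pose c1 := L22^-1 + 2 * Num.sqrt 2 * rad; pose c2 := L11 + L12 ^+ 2 * c1.
have c1_gt0 : 0 < c1 by rewrite addr_gt0 ?invr_gt0 ?mulr_gt0 ?sqrtr_gt0.
have c2_gt0 : 0 < c2.
  have [L120|L12n0] := eqVneq L12 0.
    by rewrite /c2 L120 expr0n mul0r addr0; move: L11_L12_gt0; rewrite L120 addr0.
  by rewrite ltr_wpDl // mulr_gt0 // exprn_even_gt0.
have r4 : 0 <= rad ^+ 4 by rewrite exprn_ge0 // ltW.
(* [k1] collects the constants of the condition on [del], and [k2] those of the condition on the
   gap. The final [+ 1] in [c3] keeps its logarithm nonnegative. *)
pose k1 := 128 * rad ^+ 4 * c2 ^+ 2 * (L12 + 1) ^+ 2.
have k1_ge0 : 0 <= k1 := mulr_ge0 (mulr_ge0 (mulr_ge0 (ler0n R 128) r4)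
  (sqr_ge0 c2)) (sqr_ge0 (L12 + 1)).
pose k2 := 48 * L22 ^+ 2 * rad ^+ 2.
have k2_ge0 : 0 <= k2 := mulr_ge0 (mulr_ge0 (ler0n R 48) (sqr_ge0 L22)) (sqr_ge0 rad).
pose c3 := k1 + k2 + 1.
have c3_ge1 : 1 <= c3 by rewrite lerDr addr_ge0.
have k1_le : k1 <= c3 by rewrite /c3 -addrA lerDl addr_ge0.
have k2_le : k2 <= c3 by rewrite /c3 addrAC lerDr addr_ge0.
(* The condition [4 * Lg * D <= eps ^+ 2 * T] asks for T of order u^3: one factor u from Lg, two
   from 1 / eps^2. *)
pose T eps := (Num.truncn (4 * c2 * D * (eps^-1 + 1) ^+ 3)).+1.
pose r eps := (Num.truncn (ln (c3 * (eps^-1 + 1) ^+ 6) / ln 2)).+1.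
pose N eps := inner_length L22 (lambda eps).
(* A multiple of [N eps], so that [K eps %/ N eps] is exactly [r eps]. *)
pose K eps := (N eps * r eps)%N.
have lambda_gt0 eps : 0 < eps -> 0 < lambda eps by exact: reg_weight_gt0.
have lambda_le eps : lambda eps <= L22 by exact: reg_weight_le.
have N_gt0 eps : 0 < eps -> (0 < N eps)%N.
  by move=> e0; apply: inner_length_gt0 (lambda_gt0 _ e0) (lambda_le _).
pose CT := 8 * (4 * c2 * D + 1).
pose Cr := (ln c3 + 6 * ln 2 + 6) / ln 2 + 1.
pose CN := Num.sqrt (32 * L22 * c1).
have CT_ge0 : 0 <= CT by rewrite mulr_ge0 // addr_ge0 // !mulr_ge0 // ltW.
have T_le eps : 0 < eps -> eps <= 1 -> (T eps)%:R <= CT * eps ^- 3.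
  by move=> e0 e1; apply: truncn_cube_le => //; rewrite !mulr_ge0 // ltW.
have N_le eps : 0 < eps -> eps <= 1 -> (N eps)%:R <= CN * eps `^ (- (1 / 2)).
  by move=> e0 e1; exact: inner_length_reg_weight_le.
have r_le eps : 0 < eps -> eps <= 1 -> 1 <= ln eps^-1 -> (r eps)%:R <= Cr * ln eps^-1.
  by move=> e0 e1 l1; exact: truncn_log_le.
exists T, K => run; split.
- apply: (@eqO_at_right0 _ _ _ CT 1) => // eps e0 e1.
  by rewrite ger0_norm // T_le // ltW.
- apply: (@eqO_at_right0 _ _ _ (CN * Cr) (expR (-1))) => [|eps e0 e1].
    exact: expR_gt0.
  have [e1' l1] := ln_inv_ge1 e0 e1.
  rewrite ger0_norm // natrM mulrACA.
  by rewrite ler_pM // ?N_le ?r_le.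
move=> theta0 alpha0 T0 A0; split.
  apply: (@eqO_at_right0 _ _ _ (CT * (CN * (Cr + 1) + 1)) (expR (-1))) => [|eps e0 e1].
    exact: expR_gt0.
  have [e1' l1] := ln_inv_ge1 e0 e1.
  rewrite ger0_norm // /run /step_alpha MAPGDA_evals mulKn ?N_gt0 //.
  rewrite natrM powR_7half //.
  have Te := T_le _ e0 e1'; have Ne := N_le _ e0 e1'; have re := r_le _ e0 e1' l1.
  set v := eps `^ _ in Ne *; set l := ln _ in l1 re *.
  rewrite [leRHS](_ : _ = CT * eps ^- 3 * ((CN * (Cr + 1) + 1) * (v * l))).
    2: by ring.
  apply: ler_pM => //.
  (* Needed to absorb the single theta gradient of each outer iteration. *)
  have v1 : 1 <= v.
    by rewrite -(@ler_sqr _ 1) ?nnegrE ?powR_ge0 // expr1n powR_half_sqr // invf_ge1.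
  have rl : (r eps).+1%:R <= (Cr + 1) * l.
    by rewrite -natr1 mulrDl mul1r lerD.
  rewrite -natr1 natrM mulrDl mul1r; apply: lerD.
    by rewrite mulrACA; apply: ler_pM.
  by rewrite -[leLHS]mulr1; apply: ler_pM.
move=> eps e0; pose u := eps^-1 + 1.
have l0 := lambda_gt0 _ e0; have lL := lambda_le eps.
have ei0 : 0 < eps^-1 by rewrite invr_gt0.
have u1 : 1 <= u by rewrite lerDr ltW.
have u0 : 0 < u by exact: lt_le_trans ltr01 u1.
(* Multiplying by powers of [eps * u] trades factors of [eps] on the right of a condition for
   factors of [u] on the left, for every positive [eps]. *)
have eu : 1 <= eps * u by rewrite mulrDr mulfV ?gt_eqF // mulr1 lerDl ltW.
have Lg_le : L11 + L12 ^+ 2 / lambda eps <= c2 * u.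
  rewrite mulrDl lerD ?ler_peMr // -mulrA ler_wpM2l ?sqr_ge0 //.
  exact: reg_weight_inv_le.
have r_large : c3 * u ^+ 6 <= 2 ^+ r eps.
  by apply: le_pow2; [rewrite mulr_gt0 ?exprn_gt0 //; lra|exact/ltW/truncnS_gt].
pose w : R := (1 / 2) ^+ r eps.
have w_small : c3 * u ^+ 6 * w <= 1.
  have -> : w = (2 ^+ r eps)^-1 by rewrite /w mul1r exprVn.
  by rewrite ler_pdivrMr ?exprn_gt0 // mul1r.
have w0 : 0 <= w by rewrite exprn_ge0.
(* The condition on [del] solved with [c2 * u] for Lg and [L12 + 1] for [L12]; the latter keeps the
   denominator positive when [L12 = 0]. *)
pose del := eps ^+ 2 / (8 * c2 * u * (L12 + 1) * rad).
have L121 : 0 < L12 + 1 by rewrite ltr_wpDl.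
have del0 : 0 <= del.
  by rewrite divr_ge0 ?sqr_ge0 // !mulr_ge0 // ltW.
have KN : (K eps %/ N eps)%N = r eps by rewrite mulKn ?N_gt0.
apply: (MAPGDA_finds_NE Theta_convex Theta_compact A_convex A_compact
  Theta_diam A_diam h_diff p_convex p_cont q_convex q_continuous L11_ge0 L12_ge0
  L11_L12_gt0 L22_gt0 h_L11 h_L22 h_L21 h_concave ahat_in l0 lL (N_gt0 _ e0)
  (inner_length_large l0 lL) T0 A0 _ hD del0); rewrite ?KN -/w //.
- rewrite /del expr_div_n ler_pdivlMr ?exprn_gt0 ?mulr_gt0 //.
  rewrite [leLHS](_ : _ = k1 * u ^+ 2 * w); last by rewrite /k1; ring.
  have X0 : 0 <= k1 * u ^+ 2 * w by rewrite !mulr_ge0 ?exprn_ge0 // ltW.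
  (* The exponent 6 in [r] arises here: two powers of [u] from [del ^+ 2] and four from
     [eps ^+ 4]. *)
  apply: le_trans (ler_peMr X0 (exprn_ege1 4 eu)) _.
  rewrite [leLHS](_ : _ = k1 * u ^+ 6 * w * eps ^+ 2 ^+ 2); last by ring.
  rewrite ler_piMl ?sqr_ge0 //; apply: le_trans w_small.
  by rewrite ler_wpM2r // ler_wpM2r // exprn_ge0 // ltW.
- have delE : del * (8 * c2 * u * (L12 + 1) * rad) = eps ^+ 2.
    by rewrite /del divfK // gt_eqF // !mulr_gt0.
  rewrite -delE [leRHS](_ : _ = 8 * (c2 * u * (L12 + 1)) * rad * del); last by ring.
  rewrite ler_wpM2r // ler_wpM2r ?(ltW rad_gt0) // -mulrA ler_wpM2l //.
  apply: ler_pM => //; last by rewrite lerDl.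
  by rewrite addr_ge0 // divr_ge0 ?sqr_ge0 // ltW.
- have X0 : 0 <= 4 * c2 * D * u by rewrite !mulr_ge0 // ltW.
  apply: (@le_trans _ _ (4 * c2 * D * u)).
    rewrite -mulrA [leRHS](_ : _ = 4 * (c2 * u * D)); last by ring.
    by rewrite ler_wpM2l // ler_wpM2r.
  apply: le_trans (ler_peMr X0 (exprn_ege1 2 eu)) _.
  rewrite [leLHS](_ : _ = eps ^+ 2 * (4 * c2 * D * u ^+ 3)); last by ring.
  by rewrite ler_wpM2l ?sqr_ge0 // ltW // truncnS_gt.
- exact: reg_weight_bias.
- have X0 : 0 <= k2 * w by rewrite mulr_ge0.
  apply: (@le_trans _ _ (k2 * w)).
    rewrite /k2 [leRHS](_ : _ = 48 * L22 * (L22 * rad ^+ 2 * w)); last by ring.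
    rewrite ler_wpM2l ?mulr_ge0 ?(ltW L22_gt0) // ler_wpM2r // ler_wpM2r //.
    exact: sqr_ge0.
  (* Only [eps ^+ 2] stands on the right, so [u ^+ 4] is added to reach the same sixth power. *)
  apply: le_trans (ler_peMr X0 (mulr_ege1 (exprn_ege1 2 eu) (exprn_ege1 4 u1))) _.
  rewrite [leLHS](_ : _ = k2 * u ^+ 6 * w * eps ^+ 2); last by ring.
  rewrite ler_piMl ?sqr_ge0 //; apply: le_trans w_small.
  by rewrite ler_wpM2r // ler_wpM2r // exprn_ge0 // ltW.
Qed.
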